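(* Let $\Omega\subset\mathbb{R}^n$ be a bounded polyhedral domain with simplicial triangulation $\mathcal{T}$, and let $B_f$, $f\in\Delta(\mathcal{T})$, be the components of the bubble transform $\mathcal{B}_{\mathcal{T}}$ (defined in the context). The transform $\mathcal{B}_{\mathcal{T}}$ is $L^2$ bounded, i.e. there is a constant $c=c(\Omega,\mathcal{T})$ such that $\sum_{f\in\Delta(\mathcal{T})}\|B_fu\|_{L^2(\Omega)}^2\le c\,\|u\|_{L^2(\Omega)}^2$ for all $u\in L^2(\Omega)$, and $\operatorname{supp}B_fu$ is contained in the closure of $\Omega_f$ for all $u\in L^2(\Omega)$ and all $f\in\Delta(\mathcal{T})$.
   Context: Setting: $\Omega\subset\mathbb{R}^n$ is a bounded polyhedral domain and $\mathcal{T}$ is a fixed finite (conforming) simplicial triangulation of $\Omega$ into closed $n$-simplices. $\Delta_j(\mathcal{T})$ is the set of $j$-dimensional subsimplexes of $\mathcal{T}$ and $\Delta(\mathcal{T})=\bigcup_{j=0}^n\Delta_j(\mathcal{T})$; $\Delta_n(\mathcal{T})=\mathcal{T}$; $\Delta(f)$ is the set of subsimplexes of $f$. For $f\in\Delta(\mathcal{T})$, $\mathcal{T}_f=\{T\in\mathcal{T}: f\in\Delta(T)\}$ and the macroelement is $\Omega_f=\bigcup_{T\in\mathcal{T}_f}T$. Barycentric coordinates: for a vertex $x_j$ of $\mathcal{T}$, $\lambda_j$ is the continuous piecewise linear function on $\Omega$ equal to $1$ at $x_j$ and $0$ at all other vertices. For $f=[x_0,\dots,x_m]\in\Delta_m(\mathcal{T})$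 (convex hull of its vertices), $\lambda_f=(\lambda_0,\dots,\lambda_m):\Omega\to\mathcal{S}_m^c$, where $\mathcal{S}_m^c=\{\lambda\in\mathbb{R}^{m+1}:\lambda_j\ge0,\ \sum_{j=0}^m\lambda_j\le1\}$. Put $b(\lambda)=1-\sum_{j=0}^m\lambda_j$ on $\mathcal{S}_m^c$. $\mathcal{I}_m$ is the set of all subsets $I$ of $\{0,\dots,m\}$ (including $\emptyset$), $|I|$ is the cardinality, and $P_I:\mathcal{S}_m^c\to\mathcal{S}_m^c$ sets $(P_I\lambda)_i=0$ for $i\in I$ and $(P_I\lambda)_i=\lambda_i$ for $i\notin I$. Operators: for $f=[x_0,\dots,x_m]\in\Delta_m(\mathcal{T})$ with $m<n$ and $v\in L^2(\Omega_f)$, $$A_fv(\lambda)=\frac1{|\Omega_f|}\int_{\Omega_f}v\Big(y+\sum_{j=0}^m\lambda_j(x_j-y)\Big)\,dy,\qquad \lambda\in\mathcal{S}_m^c,$$ (well defined at least where $b(\lambda)>0$), and $$C_fv(x)=\sum_{I\in\mathcal{I}_m}(-1)^{|I|}\frac{b(\lambda_f(x))}{b(P_I\lambda_f(x))}\,A_fv(P_I\lambda_f(x)),\qquad x\in\Omega .$$ For $f\in\Delta_n(\mathcal{T})$, $C_fv=v|_f$ (extended by zero to $\Omega$). The component maps of the bubble transform are defined recursively in $\dim f$: for $f\in\Delta_m(\mathcal{T})$, $$B_fu=C_fu^m,\qquad u^m=u-\sum_{g\in\Delta(\mathcal{T}),\ \dim g<m}B_gu,$$ so $u^0=u$ ($C_f$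 is applied to the restriction of $u^m$ to $\Omega_f$). *)

(* Defs.v *)
From HB Require Import structures.
From mathcomp Require Import all_boot all_order all_algebra.
From mathcomp Require Import all_classical all_reals all_analysis.

Set Implicit Arguments.
Unset Strict Implicit.
Unset Printing Implicit Defensive.

Import Order.TTheory GRing.Theory Num.Theory.
Import numFieldNormedType.Exports.

Local Open Scope classical_set_scope.
Local Open Scope ring_scope.

(** * Lebesgue measure on R^n

    R^n is ['rV[R]_n]. It carries the product sigma-algebra, generated by the
    coordinates; this is the Borel sigma-algebra of R^n. *)

Fact rv_display : measure_display.
Proof. exact: default_measure_display. Qed.

Section rv_measurable.
Context (R : realType) (n : nat).

Let coord := fun (i : 'I_n) (x : 'rV[R]_n) => x ord0 i.

Let rv_set0 : g_sigma_preimage coord set0.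
Proof. exact: sigma_algebra0. Qed.

Let rv_setC A : g_sigma_preimage coord A -> g_sigma_preimage coord (~` A).
Proof. exact: sigma_algebraC. Qed.

Let rv_bigcup (F : (set 'rV[R]_n)^nat) :
  (forall i, g_sigma_preimage coord (F i)) ->
  g_sigma_preimage coord (\bigcup_i (F i)).
Proof. exact: sigma_algebra_bigcup. Qed.

HB.instance Definition _ := @isMeasurable.Build rv_display
  'rV[R]_n (g_sigma_preimage coord) rv_set0 rv_setC rv_bigcup.

Lemma measurable_coord (i : 'I_n) :
  measurable_fun [set: 'rV[R]_n] (fun x => x ord0 i).
Proof.
move=> _ Y mY; rewrite setTI; apply: sub_sigma_algebra => /=.
rewrite -bigcup_seq/=; exists i => /=; first by rewrite mem_index_enum.
by exists Y => //; rewrite setTI.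
Qed.

Lemma measurable_fun_rv d (T : measurableType d) (f : T -> 'rV[R]_n) :
  (forall i, measurable_fun [set: T] (fun t => f t ord0 i)) ->
  measurable_fun [set: T] f.
Proof.
move=> mf.
suff : g_sigma_preimage (fun i => coord i \o f) `<=` measurable.
  by rewrite g_sigma_preimage_comp => sub _ A mA; apply: sub; exists A.
apply: smallest_sub; first exact: sigma_algebra_measurable.
rewrite -bigcup_seq => A [i _ [B mB <-]].
exact: mf.
Qed.

End rv_measurable.

Definition rv_cons (R : realType) (n : nat) (p : R * 'rV[R]_n) : 'rV[R]_n.+1 :=
  \row_i oapp (p.2 ord0) p.1 (unlift ord0 i).

Definition rv_uncons (R : realType) (n : nat) (x : 'rV[R]_n.+1) : R * 'rV[R]_n :=
  (x ord0 ord0, \row_i x ord0 (lift ord0 i)).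

Lemma rv_consK (R : realType) n : cancel (@rv_cons R n) (@rv_uncons R n).
Proof.
move=> [a x]; congr (_, _); first by rewrite mxE unlift_none.
by apply/rowP => i; rewrite !mxE liftK.
Qed.

Lemma measurable_rv_cons (R : realType) n :
  measurable_fun [set: R * 'rV[R]_n] (@rv_cons R n).
Proof.
apply: measurable_fun_rv => i; rewrite /rv_cons.
under eq_fun do rewrite mxE.
case: (unlift ord0 i) => [j|] /=; last exact: measurable_fst.
apply: (@measurableT_comp _ _ _ _ _ _ (fun x : 'rV[R]_n => x ord0 j)) => /=.
  exact: measurable_coord.
exact: measurable_snd.
Qed.

Lemma measurable_rv_uncons (R : realType) n :
  measurable_fun [set: 'rV[R]_n.+1] (@rv_uncons R n).
Proof.
apply: measurable_fun_pair; first exact: measurable_coord.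
apply: measurable_fun_rv => i.
under eq_fun do rewrite mxE.
exact: measurable_coord.
Qed.

Section lebesgue_cons.
Context (R : realType) (n : nat)
  (mu : {sigma_finite_measure set 'rV[R]_n -> \bar R}).

Definition lebesgue_cons : set 'rV[R]_n.+1 -> \bar R :=
  fun A => (@lebesgue_measure R \x mu)%E (@rv_cons R n @^-1` A).

Let m : {measure set 'rV[R]_n.+1 -> \bar R} :=
  @measure_function_pushforward__canonical__measure_function_Measure _ _ _ _ _
    (@lebesgue_measure R \x mu)%E _ (@measurable_rv_cons R n).

Let lebesgue_cons0 : lebesgue_cons set0 = 0%E.
Proof. exact: (measure0 m). Qed.

Let lebesgue_cons_ge0 A : (0 <= lebesgue_cons A)%E.
Proof. exact: (measure_ge0 m). Qed.

Let lebesgue_cons_sigma_additive : semi_sigma_additive lebesgue_cons.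
Proof. exact: (@measure_semi_sigma_additive _ _ _ m). Qed.

HB.instance Definition _ := isMeasure.Build _ _ _ lebesgue_cons
  lebesgue_cons0 lebesgue_cons_ge0 lebesgue_cons_sigma_additive.

Let lebesgue_cons_sigma_finite : sigma_finite setT lebesgue_cons.
Proof.
have /sigma_finiteP[F [TF ndF Foo]] := sigma_finiteT (@lebesgue_measure R).
have /sigma_finiteP[G [TG ndG Goo]] := sigma_finiteT mu.
exists (fun k => @rv_uncons R n @^-1` (F k `*` G k)).
  apply/esym/seteqP; split=> // x _.
  have [i _ Fi] : (\bigcup_i F i) (rv_uncons x).1 by rewrite -TF.
  have [j _ Gj] : (\bigcup_j G j) (rv_uncons x).2 by rewrite -TG.
  exists (maxn i j) => //; split.
    by move: Fi; exact/subsetPset/ndF/leq_maxl.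
  by move: Gj; exact/subsetPset/ndG/leq_maxr.
move=> k; have [mF Fk] := Foo k; have [mG Gk] := Goo k; split.
  rewrite -[X in measurable X]setTI; apply: measurable_rv_uncons => //.
  exact: measurableX.
rewrite /lebesgue_cons -comp_preimage.
have -> : @rv_uncons R n \o @rv_cons R n = id by apply/funext/rv_consK.
rewrite preimage_id.
by rewrite product_measure1E// lte_mul_pinfty// ge0_fin_numE.
Qed.

HB.instance Definition _ := Measure_isSigmaFinite.Build _ _ _ lebesgue_cons
  lebesgue_cons_sigma_finite.

End lebesgue_cons.

(** Lebesgue measure on R^n, as an n-fold product of [lebesgue_measure]. *)
Fixpoint lebesgue_rv (R : realType) (n : nat) :
    {sigma_finite_measure set 'rV[R]_n -> \bar R} :=
  match n return {sigma_finite_measure set 'rV[R]_n -> \bar R} with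
  | 0 => @dirac _ 'rV[R]_0 0 R
  | k.+1 => lebesgue_cons (lebesgue_rv R k)
  end.

(** Functions on [Om] are represented by functions on R^n extended by zero. *)
Definition inL2 (R : realType) (n : nat) (Om : set 'rV[R]_n)
    (u : 'rV[R]_n -> R) : Prop :=
  u \_ Om \in Lfun (lebesgue_rv R n) 2%:E.

Definition L2norm (R : realType) (n : nat) (Om : set 'rV[R]_n)
    (u : 'rV[R]_n -> R) : \bar R :=
  'N[lebesgue_rv R n]_2%:E[EFin \o (u \_ Om)]%E.

(** The support of an element of L^2([Om]), i.e. the complement of the largest
    open set on which it vanishes almost everywhere. *)
Definition ess_support (R : realType) (n : nat) (Om : set 'rV[R]_n)
    (u : 'rV[R]_n -> R) : set 'rV[R]_n :=
  [set x | forall U : set 'rV[R]_n, open_nbhs x U ->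
     ~ {ae lebesgue_rv R n, forall y, (U `&` Om) y -> u y = 0}].

(** * Polyhedral domains and triangulations *)

Definition hyperplane (R : realType) (n : nat) (w : 'cV[R]_n) (c : R) :
    set 'rV[R]_n :=
  [set y | (y *m w) ord0 ord0 = c].

Definition bounded_polyhedral_domain (R : realType) (n : nat)
    (Om : set 'rV[R]_n) : Prop :=
  [/\ Om !=set0, open Om, connected Om, bounded_set Om &
      exists H : seq ('cV[R]_n * R),
        (forall h, h \in H -> h.1 != 0) /\
        closure Om `\` Om `<=` \bigcup_(h in [set` H]) hyperplane h.1 h.2].

Definition affinely_independent (R : realType) (n : nat) (V : finType)
    (x : V -> 'rV[R]_n) (f : {set V}) : Prop :=
  forall a : V -> R, \sum_(i in f) a i = 0 -> \sum_(i in f) a i *: x i = 0 ->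
    forall i, i \in f -> a i = 0.

(** Convex hull of the points [x i], [i \in f]. *)
Definition simplex (R : realType) (n : nat) (V : finType)
    (x : V -> 'rV[R]_n) (f : {set V}) : set 'rV[R]_n :=
  [set y | exists a : V -> R, [/\ forall i, 0 <= a i,
     \sum_(i in f) a i = 1 & y = \sum_(i in f) a i *: x i]].

(** A simplex is given by its set of vertices; vertices are indexed by a finite
    type. *)
Record triangulation (R : realType) (n : nat) (Om : set 'rV[R]_n) :=
  Triangulation {
  vtx : finType;
  pos : vtx -> 'rV[R]_n;
  cells : {set {set vtx}};
  pos_inj : injective pos;
  vtx_in_cell : forall i, exists2 K, K \in cells & i \in K;
  cell_card : forall K, K \in cells -> #|K| = n.+1;
  cell_indep : forall K, K \in cells -> affinely_independent pos K;
  cells_conforming : forall K L, K \in cells -> L \in cells ->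
    simplex pos K `&` simplex pos L = simplex pos (K :&: L);
  cells_cover : \bigcup_(K in [set` cells]) simplex pos K = closure Om }.

Section bubble.
Context (R : realType) (n : nat) (Om : set 'rV[R]_n) (T : triangulation Om).
Local Notation E := 'rV[R]_n.
Local Notation V := (vtx T).
Local Notation x_ := (@pos R n Om T).
Local Notation mu := (lebesgue_rv R n).

(** The set Delta(T) of all subsimplexes. *)
Definition subsimplexes : {set {set V}} :=
  [set f : {set V} | (f != finset.set0) && [exists K in cells T, f \subset K]]%SET.

Definition dim (f : {set V}) : nat := #|f|.-1.

Definition macroelement (f : {set V}) : set E :=
  \bigcup_(K in [set K | K \in cells T /\ f \subset K]) simplex x_ K.

(** The defining properties of the barycentric coordinate of the vertex [i].
    The closure of [Om], rather than [Om], is used because vertices may lie on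
    the boundary. *)
Definition is_barycentric (i : V) (l : E -> R) : Prop :=
  [/\ {within closure Om, continuous l},
      forall K, K \in cells T -> exists (w : 'cV[R]_n) (c : R),
        forall y, simplex x_ K y -> l y = (y *m w) ord0 ord0 + c &
      forall j, l (x_ j) = (j == i)%:R].

(** [is_barycentric i] determines its values on the closure of [Om], and only
    these values are used. *)
Definition bary (i : V) : E -> R := xget (cst 0) [set l | is_barycentric i l].

(** Points [lambda] of S_m^c are functions on all vertices, of which only the
    values on [f] matter; subsets of {0, .., m} become subsets of [f]. *)
Definition bary_at (y : E) : V -> R := fun i => bary i y.

Definition bfun (f : {set V}) (lambda : V -> R) : R :=
  1 - \sum_(j in f) lambda j.

Definition proj (I : {set V}) (lambda : V -> R) : V -> R :=
  fun i => if i \in I then 0 else lambda i.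

Definition Aop (f : {set V}) (v : E -> R) (lambda : V -> R) : R :=
  (fine (mu (macroelement f)))^-1 *
  \int[mu]_(y in macroelement f)
    v (y + \sum_(j in f) lambda j *: (x_ j - y)).

(** When [dim f < n] and [x] lies on [f], [bfun] vanishes and the quotient is
    the conventional [0 / 0 = 0]; such [x] form a null set. *)
Definition Cop (f : {set V}) (v : E -> R) : E -> R :=
  (if dim f == n then v \_ (simplex x_ f)
   else fun x => \sum_(I : {set V} | I \subset f)
     (-1) ^+ #|I| * (bfun f (bary_at x) / bfun f (proj I (bary_at x)))
       * Aop f v (proj I (bary_at x))) \_ Om.

(** [residual m u] is u^m; see [residualE]. *)
Fixpoint residual (m : nat) (u : E -> R) : E -> R :=
  match m with
  | 0 => u \_ Om
  | k.+1 => residual k u -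
      \sum_(g in subsimplexes | dim g == k) Cop g (residual k u)
  end.

Definition bubble (f : {set V}) (u : E -> R) : E -> R :=
  Cop f (residual (dim f) u).

Lemma residualE (m : nat) (u : E -> R) :
  residual m u =
  u \_ Om - \sum_(g in subsimplexes | (dim g < m)%N) bubble g u.
Proof.
elim: m => [|m IH]; first by rewrite big_pred0 ?subr0// => g; rewrite andbF.
rewrite /= {1}IH -addrA -opprD; congr (_ - _).
rewrite [RHS](bigID (fun g => dim g < m)%N)/=; congr (_ + _).
  apply: eq_bigl => g; rewrite -andbA; congr (_ && _).
  by rewrite ltnS andb_idl// => /ltnW.
transitivity (\sum_(g in subsimplexes | dim g == m) bubble g u).
  by apply: eq_bigr => g /andP[_ /eqP gm]; rewrite /bubble gm.
apply: eq_bigl => g; rewrite -andbA; congr (_ && _).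
by rewrite -leqNgt ltnS -eqn_leq.
Qed.

End bubble.

(* Main.v *)
From HB Require Import structures.
From mathcomp Require Import all_boot all_order all_algebra.
From mathcomp Require Import all_classical all_reals all_analysis.
From mathcomp Require Import measurable_realfun.
From mathcomp Require Import ring lra.
Require Import Defs.

(** Write [b] for the complement [1 - sum] of the coordinates retained in
    [P_I lambda_f], on a cell [K] for [x] and on a cell [K'] for [y] and [z]. The
    mean [A_f v (P_I lambda_f(x))] averages [v (z)] over [y], where [y |-> z] is a
    homothety of ratio [b x] mapping [K'] into itself, with [b z = b x * b y].
    Cauchy-Schwarz with the weight [sqrt (b y)] costs only the finite integral of
    [(b y)^(-1/2)] over [K'], whereas without weight a divergent factor
    [log (1 / b z)] would remain. Changing variables from [y] to [z] and
    exchanging the integrals leaves to bound, uniformly in [z], the integral of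
    [sqrt (b z / b x) * (b x)^-n] over the [x] with [lambda_j x <= lambda_j z] for
    the retained [j]. Those with [b x <= t] have their barycentric coordinates in
    intervals of length [t], hence form a set of measure [O(t^n)], and summing
    over the layers [b x ~ 4^i * b z] gives a geometric series. This bounds
    [C_f v] on the cells containing [f]; elsewhere some coordinate of [lambda_f]
    vanishes and the alternating sum over [I] cancels. The bound for [B_f] follows
    by induction on [dim f]. *)

Set Implicit Arguments.
Unset Strict Implicit.
Unset Printing Implicit Defensive.

Import Order.TTheory GRing.Theory Num.Theory.
Import numFieldNormedType.Exports.

Local Open Scope classical_set_scope.
Local Open Scope ring_scope.

(** * Lebesgue measure on R^n *)

Lemma Lnorm2_sqr d (T : measurableType d) (R : realType)
    (mu : {measure set T -> \bar R}) (f : T -> R) :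
  ('N[mu]_2%:E[EFin \o f] ^+ 2 = \int[mu]_x (f x ^+ 2)%:E)%E.
Proof.
have -> : ('N[mu]_2%:E[EFin \o f] = sqrte (\int[mu]_x (f x ^+ 2)%:E))%E.
  rewrite unlock poweR12_sqrt; last first.
    by apply: integral_ge0 => x _; exact: poweR_ge0.
  congr sqrte; apply: eq_integral => x _.
  change ((`|f x|)%:E `^ 2 = (f x ^+ 2)%:E)%E.
  by rewrite poweR_EFin powR_mulrn// real_normK// num_real.
by rewrite sqr_sqrte//; apply: integral_ge0 => x _; rewrite lee_fin sqr_ge0.
Qed.

(** Hölder with exponents 2 and 2, squared. Working in the extended reals avoids any integrability
    assumption. *)
Lemma cauchy_schwarz_sqr d (T : measurableType d) (R : realType)
    (mu : {measure set T -> \bar R}) (f g : T -> R) :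
  measurable_fun setT f -> measurable_fun setT g ->
  ((\int[mu]_x `|f x * g x|%:E) ^+ 2 <=
    (\int[mu]_x (f x ^+ 2)%:E) * \int[mu]_x (g x ^+ 2)%:E)%E.
Proof.
move=> mf mg.
have h2 : 2^-1 + 2^-1 = 1 :> R by field.
have := @hoelder _ _ _ mu f g 2 2 mf mg ltac:(by []) ltac:(by []) h2.
rewrite Lnorm1 => h.
rewrite -!Lnorm2_sqr !expe2 muleACA.
have i0 : (0 <= \int[mu]_x `|f x * g x|%:E)%E.
  by apply: integral_ge0 => x _; rewrite lee_fin.
exact: lee_pmul.
Qed.

Lemma integral_lebesgue_rvS (R : realType) n (F : 'rV[R]_n.+1 -> \bar R) :
  measurable_fun setT F -> (forall x, 0 <= F x)%E ->
  (\int[lebesgue_rv R n.+1]_x F x =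
   \int[lebesgue_rv R n]_y \int[@lebesgue_measure R]_s F (rv_cons (s, y)))%E.
Proof.
move=> mF F0.
(* [lebesgue_cons] is by definition the pushforward of this product measure. *)
transitivity (\int[pushforward (@lebesgue_measure R \x lebesgue_rv R n)%E
   (@rv_cons R n)]_x F x)%E.
  by [].
rewrite ge0_integral_pushforward//; last exact: measurable_rv_cons.
rewrite preimage_setT.
apply: (fubini_tonelli2 (m1 := @lebesgue_measure R) (m2 := lebesgue_rv R n)
  (F \o @rv_cons R n)) => [|x]; last exact: F0.
by apply: measurableT_comp => //; exact: measurable_rv_cons.
Qed.

Lemma measurable_rv_cons_swap (R : realType) n :
  measurable_fun setT (fun p : 'rV[R]_n * R => rv_cons (p.2, p.1)).
Proof.
apply: (@measurableT_comp _ _ _ _ _ _ (@rv_cons R n)) => /=.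
  exact: measurable_rv_cons.
by apply: measurable_fun_pair; [exact: measurable_snd | exact: measurable_fst].
Qed.

(** [r] times the image of Lebesgue measure under the affine map agrees with Lebesgue measure on
    half-open intervals, hence on all measurable sets by uniqueness. *)
Lemma integral_affine1 (R : realType) (F : R -> \bar R) (r a : R) : 0 < r ->
  measurable_fun setT F -> (forall x, 0 <= F x)%E ->
  (\int[@lebesgue_measure R]_s F (r * s + a)%R =
   r^-1%:E * \int[@lebesgue_measure R]_s F s)%E.
Proof.
move=> r0 mF F0.
pose phi (s : measurableTypeR R) : measurableTypeR R := r * s + a.
have mphi : measurable_fun setT phi.
  by apply: measurable_funD => //; exact: measurable_funM.
pose nu : {measure set (measurableTypeR R) -> \bar R} :=
  mscale (NngNum (ltW r0))
    (@measure_function_pushforward__canonical__measure_function_Measure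
       _ _ _ _ _ (@lebesgue_measure R) phi mphi).
have E A : measurable A -> lebesgue_measure A = nu A.
  apply: lebesgue_measure_unique => _ [[x y]] _ <-.
  change (lebesgue_measure `]x, y]%classic =
    r%:E * lebesgue_measure (phi @^-1` `]x, y]%classic))%E.
  have -> : phi @^-1` `]x, y]%classic =
      `](x - a) / r, (y - a) / r]%classic.
    apply/seteqP; split => s /=; rewrite !in_itv/= /phi.
      by rewrite ltr_pdivrMr// ler_pdivlMr// ltrBlDr lerBrDr mulrC.
    by rewrite ltr_pdivrMr// ler_pdivlMr// ltrBlDr lerBrDr mulrC.
  rewrite !lebesgue_measure_itv/= !lte_fin ltr_pM2r ?invr_gt0// ltrBlDr subrK.
  case: ifPn => _; last by rewrite mule0.
  rewrite -!EFinB -EFinM; congr EFin; field.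
  by rewrite gt_eqF.
have -> : (\int[@lebesgue_measure R]_s F s = \int[nu]_s F s)%E.
  by apply: eq_measure_integral => A mA _; exact: E.
rewrite ge0_integral_mscale//= ge0_integral_pushforward// preimage_setT.
by rewrite muleA -EFinM mulVf ?gt_eqF// mul1e.
Qed.

Lemma measurable_rv_addZ d (T : measurableType d) (R : realType) n
    (r : T -> R) (f g : T -> 'rV[R]_n) :
  measurable_fun setT r -> measurable_fun setT f -> measurable_fun setT g ->
  measurable_fun setT (fun t => r t *: f t + g t).
Proof.
move=> mr mf mg; apply: measurable_fun_rv => i.
under eq_fun do rewrite !mxE.
apply: measurable_funD; first apply: measurable_funM => //.
  by apply: (measurableT_comp (measurable_coord i)).
by apply: (measurableT_comp (measurable_coord i)).
Qed.

(** Induction on [n]: Tonelli splits off the first coordinate, and each coordinate contributes one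
    factor [r^-1]. *)
Lemma integral_affine_rv (R : realType) n (F : 'rV[R]_n -> \bar R) (r : R) a :
  0 < r -> measurable_fun setT F -> (forall x, 0 <= F x)%E ->
  (\int[lebesgue_rv R n]_y F (r *: y + a)%R =
   (r ^- n)%R%:E * \int[lebesgue_rv R n]_y F y)%E.
Proof.
move=> r0; elim: n F a => [|n IH] F a mF F0.
  rewrite expr0 invr1 mul1e; apply: eq_integral => y _; congr F.
  by rewrite !thinmx0.
have mF'' y : measurable_fun setT (fun s : R => F (rv_cons (s, y))).
  apply: measurableT_comp => //.
  apply: (@measurableT_comp _ _ _ _ _ _ (@rv_cons R n)) => /=.
    exact: measurable_rv_cons.
  by apply: measurable_fun_pair.
rewrite !integral_lebesgue_rvS//; last first.
  by apply: measurableT_comp => //; exact: measurable_rv_addZ.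
pose G y := (\int[@lebesgue_measure R]_s F (rv_cons (s, y)))%E.
pose b := (rv_uncons a).1; pose c := (rv_uncons a).2.
transitivity (\int[lebesgue_rv R n]_y (r^-1%:E * G (r *: y + c)%R))%E.
  apply: eq_integral => y _; rewrite -(@integral_affine1 _ _ _ b)//.
  apply: eq_integral => s _; congr F.
  apply/rowP => i; rewrite !mxE; case: unliftP => [j|] -> /=.
    by rewrite !mxE.
  by [].
have mG : measurable_fun setT G.
  apply: (@measurable_fun_fubini_tonelli_F _ _ _ _ _ (@lebesgue_measure R)
    (fun p : 'rV[R]_n * R => F (rv_cons (p.2, p.1)))) => //.
  exact: measurableT_comp mF (@measurable_rv_cons_swap R n).
have G0 y : (0 <= G y)%E by apply: integral_ge0.
rewrite ge0_integralZl//; [|..].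
- by rewrite IH// muleA -EFinM -invfM -exprS.
- by apply: measurableT_comp => //; exact: measurable_rv_addZ.
- by rewrite lee_fin invr_ge0 ltW.
Qed.

Definition box (R : realType) n (a : 'rV[R]_n) (d : R) : set 'rV[R]_n :=
  [set x | forall i, `|x ord0 i - a ord0 i| <= d].

Lemma measurable_box (R : realType) n (a : 'rV[R]_n) d : measurable (box a d).
Proof.
have -> : box a d =
    \bigcap_(i in [set: 'I_n]) [set x | `|x ord0 i - a ord0 i| <= d].
  by apply/seteqP; split => x xa i; [move=> _|]; exact: xa.
apply: fin_bigcap_measurable; first exact: finite_finset.
move=> i _.
rewrite -[X in measurable X]setTI.
rewrite [X in _ `&` X](_ : _ = (fun x : 'rV[R]_n => `|x ord0 i - a ord0 i|)
  @^-1` `]-oo, d]%classic).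
  have : measurable_fun setT (fun x : 'rV[R]_n => `|x ord0 i - a ord0 i|).
    apply: measurableT_comp => //; apply: measurable_funB => //.
    exact: measurable_coord.
  by apply => //; exact: measurable_itv.
by apply/seteqP; split => x /=; rewrite in_itv.
Qed.

Lemma lebesgue_rv_le_prod (R : realType) n (A : set 'rV[R]_n.+1)
    (B : set R) (C : set 'rV[R]_n) :
  measurable A -> measurable B -> measurable C ->
  (forall s y, A (rv_cons (s, y)) -> B s /\ C y) ->
  (lebesgue_rv R n.+1 A <= @lebesgue_measure R B * lebesgue_rv R n C)%E.
Proof.
move=> mA mB mC ABC.
have <- : ((@lebesgue_measure R \x lebesgue_rv R n) (B `*` C) =
   @lebesgue_measure R B * lebesgue_rv R n C)%E.
  exact: product_measure1E.
rewrite /= /lebesgue_cons; apply: le_measure; rewrite ?inE.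
- rewrite -[X in measurable X]setTI; exact: measurable_rv_cons.
- exact: measurableX.
- by move=> [s y] /= /ABC.
Qed.

Lemma lebesgue_segment (R : realType) (p d : R) : 0 <= d ->
  @lebesgue_measure R [set s | `|s - p| <= d] = (2 * d)%:E.
Proof.
move=> d0; have -> : [set s | `|s - p| <= d] = `[p - d, p + d]%classic.
  by apply/seteqP; split => s /=; rewrite in_itv/= ler_distl.
rewrite lebesgue_measure_itv/= lte_fin.
case: ltP => h; first by rewrite -EFinB; congr EFin; ring.
by congr EFin; lra.
Qed.

Lemma measurable_segment (R : realType) (p d : R) :
  measurable [set s | `|s - p| <= d].
Proof.
have -> : [set s | `|s - p| <= d] = `[p - d, p + d]%classic.
  by apply/seteqP; split => s /=; rewrite in_itv/= ler_distl.
exact: measurable_itv.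
Qed.

Lemma lebesgue_box (R : realType) n (a : 'rV[R]_n) d : 0 <= d ->
  (lebesgue_rv R n (box a d) <= ((2 * d) ^+ n)%:E)%E.
Proof.
move=> d0; elim: n a => [|n IH] a.
  by rewrite expr0 /= diracE; case: (_ \in _); rewrite ?lee_fin.
pose a' := (rv_uncons a).2.
apply: (@le_trans _ _ (@lebesgue_measure R [set s | (`|s - a ord0 ord0| <= d)%R] *
    lebesgue_rv R n (box a' d))%E).
  apply: lebesgue_rv_le_prod; [exact: measurable_box|exact: measurable_segment|
    exact: measurable_box|].
  move=> s y h; split => [|i] /=.
    by have := h ord0; rewrite mxE unlift_none.
  by have := h (lift ord0 i); rewrite !mxE liftK.
rewrite lebesgue_segment// exprS [X in (_ <= X)%E]EFinM lee_wpmul2l ?IH// lee_fin.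
exact: mulr_ge0.
Qed.

Definition affine (R : realType) n (h : 'rV[R]_n -> R) :=
  exists (w : 'cV[R]_n) (c : R), forall y, h y = (y *m w) ord0 ord0 + c.

Lemma affine_measurable (R : realType) n (h : 'rV[R]_n -> R) :
  affine h -> measurable_fun setT h.
Proof.
move=> [w [c hE]]; rewrite (_ : h = fun y => \sum_i y ord0 i * w i ord0 + c).
  apply: measurable_funD => //.
  apply: (@measurable_sum _ _ _ _ _ _ (fun i (y : 'rV[R]_n) => y ord0 i * w i
    ord0)) => i.
  apply: measurable_funM => //; exact: measurable_coord.
by apply/funext => y; rewrite hE mxE.
Qed.

Lemma measurable_le_fun d (T : measurableType d) (R : realType) (f g : T -> R) :
  measurable_fun setT f -> measurable_fun setT g ->
  measurable [set x | f x <= g x].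
Proof.
move=> mf mg; rewrite -[X in measurable X]setTI.
rewrite [X in _ `&` X](_ : _ = (fun x => f x <= g x) @^-1` [set true]).
  by have := measurable_fun_ler mf mg; apply.
by apply/seteqP; split.
Qed.

(** Induction on [n]. If the first coefficient of [w] is nonzero, each line parallel to the first
    axis meets the slab in a segment of length proportional to [t]; otherwise the slab is a cylinder
    over one of lower dimension. In dimension 0 the function is a constant [c != 0], and the set is
    empty unless [t >= |c|]. *)
Lemma slab_measure (R : realType) n (w : 'cV[R]_n) (c M : R) : 0 <= M ->
  (exists y : 'rV[R]_n, (y *m w) ord0 ord0 + c != 0) ->
  exists2 C, 0 <= C & forall t, 0 <= t ->
    (lebesgue_rv R n
      (box 0 M `&` [set y : 'rV[R]_n | (`|(y *m w) ord0 ord0 + c| <= t)%R]) <=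
        (C * t)%:E)%E.
Proof.
move=> M0; elim: n w => [|n IH] w [y0 y0P].
  exists `|c|^-1 => [|t t0]; first by rewrite invr_ge0.
  have wE (y : 'rV[R]_0) : (y *m w) ord0 ord0 = 0 by rewrite (flatmx0 w) mulmx0
    mxE.
  move: y0P; rewrite wE add0r => c0.
  rewrite /= diracE; case: (boolP (_ \in _)) => [|_]; last first.
    by rewrite lee_fin mulr_ge0// invr_ge0.
  rewrite inE => -[_ /=]; rewrite wE add0r => ct.
  by rewrite lee_fin mulrC ler_pdivlMr ?normr_gt0// mul1r.
pose w' : 'cV[R]_n := \col_i w (lift ord0 i) ord0.
have wE s y : (rv_cons (s, y) *m w) ord0 ord0 =
    s * w ord0 ord0 + (y *m w') ord0 ord0.
  rewrite !mxE big_ord_recl !mxE unlift_none/=; congr (_ + _).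
  by apply: eq_bigr => i _; rewrite !mxE liftK.
have mA k (v : 'cV[R]_k) t : measurable (box 0 M `&`
    [set y : 'rV[R]_k | `|(y *m v) ord0 ord0 + c| <= t]).
  apply: measurableI; first exact: measurable_box.
  apply: measurable_le_fun => //; apply: measurableT_comp => //.
  by apply: affine_measurable; exists v, c.
have boxP s y : box 0 M (rv_cons (s, y)) -> `|s - 0| <= M /\ box 0 M y.
  move=> h; split => [|i].
    by have := h ord0; rewrite !mxE unlift_none.
  by have := h (lift ord0 i); rewrite !mxE liftK.
have [w0|w0] := eqVneq (w ord0 ord0) 0; last first.
  exists (2 / `|w ord0 ord0| * (2 * M) ^+ n) => [|t t0].
    by rewrite !mulr_ge0// ?invr_ge0// exprn_ge0// mulr_ge0.
  set A := (X in lebesgue_rv R _ X).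
  have mA' : measurable A by exact: mA.
  have -> : lebesgue_rv R n.+1 A =
      (\int[lebesgue_rv R n.+1]_x (\1_A x)%:E)%E by rewrite integral_indic//
        setIT.
  rewrite integral_lebesgue_rvS; last 2 first.
  - exact/measurable_EFinP/measurable_indic.
  - by move=> x; rewrite lee_fin.
  set k := 2 / _.
  apply: (@le_trans _ _ (\int[lebesgue_rv R n]_y
      ((k * t)%:E * (\1_(box 0 M) y)%:E))%E); last first.
    rewrite ge0_integralZl//; last 2 first.
    - apply/measurable_EFinP; apply: measurable_indic; exact: measurable_box.
    - by rewrite lee_fin !mulr_ge0// invr_ge0.
    rewrite integral_indic//; last exact: measurable_box.
    have -> : k * (2 * M) ^+ n * t = (k * t) * (2 * M) ^+ n by exact: mulrAC.
    rewrite setIT [X in (_ <= X)%E]EFinM lee_wpmul2l ?lebesgue_box//.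
    by rewrite lee_fin !mulr_ge0// invr_ge0.
  apply: ge0_le_integral => //.
  - by move=> y _; apply: integral_ge0 => s _; rewrite lee_fin.
  - apply: (@measurable_fun_fubini_tonelli_F _ _ _ _ _ (@lebesgue_measure R)
      (fun p : 'rV[R]_n * R => (\1_A (rv_cons (p.2, p.1)))%:E)) => [|p].
      apply/measurable_EFinP.
      apply: (measurableT_comp _ (@measurable_rv_cons_swap R n)).
      exact: measurable_indic.
    by rewrite lee_fin.
  - apply/measurable_EFinP; apply: measurable_funM => //.
    apply: measurable_indic; exact: measurable_box.
  move=> y _.
  (* On the line over [y] the affine function vanishes at [p] and has slope [w ord0 ord0]. *)
  pose p := - ((y *m w') ord0 ord0 + c) / w ord0 ord0.
  pose I := [set s | `|s - p| <= t / `|w ord0 ord0|].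
  have mI : measurable I by exact: measurable_segment.
  apply: (@le_trans _ _ (\int[@lebesgue_measure R]_s
      ((\1_(box 0 M) y)%:E * (\1_I s)%:E))%E).
    apply: ge0_le_integral => //.
    - apply/measurable_EFinP.
      apply: (@measurableT_comp _ _ _ _ _ _ (\1_A : _ -> R)).
        exact: measurable_indic.
      apply: measurableT_comp; first exact: measurable_rv_cons.
      exact: measurable_fun_pair.
    - by apply/measurable_EFinP; apply: measurable_funM.
    - move=> s _; rewrite -EFinM lee_fin indicE.
      case: (boolP (_ \in _)) => [|_]; last by rewrite mulr_ge0.
      rewrite inE => -[/boxP[_ by_] /=]; rewrite wE -addrA => st.
      rewrite !indicE mem_set//= mem_set ?mulr1// /I/= ler_pdivlMr ?normr_gt0//.
      rewrite -normrM; apply: le_trans st; rewrite /p le_eqVlt; apply/orP; left.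
      by apply/eqP; congr (`|_|); field.
  rewrite ge0_integralZl//; last first.
    by apply/measurable_EFinP; exact: measurable_indic.
  rewrite integral_indic// setIT muleC lee_wpmul2r ?lee_fin//.
  change (@lebesgue_measure R I <= (k * t)%:E)%E.
  rewrite /I lebesgue_segment ?divr_ge0// lee_fin /k le_eqVlt; apply/orP; left.
  by apply/eqP; ring.
(* The function does not depend on the first coordinate here, so the tail of [y0] shows that it is
   still not identically zero. *)
have [y1 y1P] : exists y : 'rV[R]_n, (y *m w') ord0 ord0 + c != 0.
  exists (rv_uncons y0).2; move: y0P.
  have -> : y0 = rv_cons (rv_uncons y0).
    apply/rowP => i; rewrite !mxE; case: unliftP => [j|] -> //=.
    by rewrite mxE.
  by case: (rv_uncons y0) => s y; rewrite rv_consK wE w0 mulr0 add0r.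
have [C C0 CP] := IH w' (ex_intro _ y1 y1P).
exists (2 * M * C) => [|t t0]; first by rewrite !mulr_ge0.
apply: (@le_trans _ _ (@lebesgue_measure R [set s | (`|s - 0| <= M)%R] *
    lebesgue_rv R n (box 0 M `&` [set y : 'rV[R]_n |
      (`|(y *m w') ord0 ord0 + c| <= t)%R]))%E).
  apply: lebesgue_rv_le_prod; [exact: mA|exact: measurable_segment|exact: mA|].
  move=> s y [/boxP[sM yM] /=]; rewrite wE w0 mulr0 add0r => h.
  by split => //; split.
rewrite lebesgue_segment//.
have -> : 2 * M * C * t = (2 * M) * (C * t) by rewrite mulrA.
rewrite [X in (_ <= X)%E]EFinM.
by apply: lee_wpmul2l; [rewrite lee_fin mulr_ge0|exact: CP].
Qed.

(** * Averages over homotheties *)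

Lemma measurable_sqrtr (R : realType) : measurable_fun setT (@Num.sqrt R).
Proof.
by apply: nondecreasing_measurable => // x y; exact: ler_wsqrtr.
Qed.

Lemma measurable_invr (R : realType) : measurable_fun setT (@GRing.inv R).
Proof.
(* The real power is the inverse only on nonnegative bases, hence the square; the factor [x]
   restores the sign and gives the value 0 at 0. *)
rewrite (_ : GRing.inv = fun x : R => x * (x ^+ 2) `^ (- 1)).
  apply: measurable_funM => //; apply:
    (@measurableT_comp _ _ _ _ _ _ (fun x : R => x `^ (- 1))).
    exact: measurable_powR.
  exact: exprn_measurable.
apply/funext => x; rewrite powR_inv1 ?sqr_ge0//.
have [->|x0] := eqVneq x 0; first by rewrite invr0 mul0r.
by field.
Qed.

(** Index of the layer containing [x]. The base is 4 so that the square roots of the layer bounds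
    are powers of 2. *)
Lemma pow4_sandwich (R : realType) (x : R) : 1 <= x ->
  exists i, 4 ^+ i <= x < 4 ^+ i.+1.
Proof.
move=> x1; have x0 : 0 <= x by apply: le_trans x1.
have ex : exists i, x < 4 ^+ i.
  exists (Num.Def.archi_bound x); apply: lt_trans (archi_boundP x0) _.
  by rewrite -natrX ltr_nat ltn_expl.
have [[|i] xi imin] := ex_minnP ex; first by move: xi; rewrite expr0 ltNge x1.
exists i; rewrite xi andbT leNgt; apply/negP => /imin; by rewrite ltnn.
Qed.

Lemma sqrt_pow4 (R : realType) i : Num.sqrt (4 ^+ i) = 2 ^+ i :> R.
Proof.
have -> : 4 ^+ i = (2 ^+ i) ^+ 2 :> R.
  by rewrite -exprM mulnC exprM; congr (_ ^+ _); ring.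
by rewrite sqrtr_sqr ger0_norm// exprn_ge0.
Qed.

Lemma nneseries_geometric_le (R : realType) (a q : R) : 0 <= a -> 0 <= q < 1 ->
  (\sum_(0 <= i <oo) (a * q ^+ i)%:E <= (a / (1 - q))%:E)%E.
Proof.
move=> a0 /andP[q0 q1]; apply: lime_le.
  by apply: is_cvg_nneseries => i _ _; rewrite lee_fin mulr_ge0// exprn_ge0.
apply: nearW => k; rewrite sumEFin lee_fin -mulr_sumr ler_wpM2l//.
rewrite -[leRHS]mul1r ler_pdivlMr ?subr_gt0//.
have := subrX1 q k; rewrite big_mkord.
suff : 0 <= q ^+ k by lra.
exact: exprn_ge0.
Qed.

Lemma le_nneseries_term (R : realType) (u : nat -> \bar R) i :
  (forall j, 0 <= u j)%E -> (u i <= \sum_(0 <= j <oo) u j)%E.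
Proof.
move=> u0; apply: (@le_trans _ _ (\sum_(0 <= j < i.+1) u j)%E).
  by rewrite big_nat_recr//= leeDr// sume_ge0.
exact: nneseries_lim_ge.
Qed.

(** Where [4^i <= 1 / h y < 4^(i+1)], the integrand is at most [2 * 2^i] and [y] lies in the slab
    [h <= 4^-i], of measure at most [C * 4^-i]. The products [2 * C * 2^-i] sum to [4 * C]. *)
Lemma integral_inv_sqrt_le d (T : measurableType d) (R : realType)
    (mu : {measure set T -> \bar R}) (D : set T) (h : T -> R) (C : R) :
  measurable D -> measurable_fun setT h -> 0 <= C ->
  (forall t : R, (0 <= t)%R ->
    mu (D `&` [set y | (h y <= t)%R]) <= (C * t)%:E)%E ->
  (forall y, D y -> h y <= 1) ->
  (\int[mu]_y (\1_(D `&` [set y | (0 < h y)%R]) y * (Num.sqrt (h y))^-1)%:E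
    <= (4 * C)%:E)%E.
Proof.
move=> mD mh C0 slab h1.
have mDt t : measurable (D `&` [set y | h y <= t]).
  by apply: measurableI => //; exact: measurable_le_fun.
pose u i y : \bar R :=
  (2 * 2 ^+ i * \1_(D `&` [set y | (h y <= 4 ^- i)%R]) y)%:E.
have u0 i y : (0 <= u i y)%E by rewrite lee_fin !mulr_ge0// exprn_ge0.
have mu_ i : measurable_fun setT (u i).
  by apply/measurable_EFinP; apply: measurable_funM => //;
    exact: measurable_indic.
have mD' : measurable (D `&` [set y | 0 < h y]).
  rewrite (_ : [set y | 0 < h y] = ~` [set y | h y <= 0]); last first.
    by apply/seteqP; split => y /=; [move=> ?; apply/negP; rewrite -ltNge|
      move/negP; rewrite -ltNge].
  by apply: measurableI => //; apply: measurableC; exact: measurable_le_fun.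
apply: (@le_trans _ _ (\int[mu]_y \sum_(0 <= i <oo) u i y)%E).
  apply: ge0_le_integral => //.
  - apply/measurable_EFinP/measurable_funM; first exact: measurable_indic.
    apply: (measurableT_comp (@measurable_invr R)).
    exact: (measurableT_comp (@measurable_sqrtr R)).
  - exact: ge0_emeasurable_sum.
  - move=> y _; rewrite indicE; case: (boolP (_ \in _)) => [|_]; last first.
      by rewrite mul0r nneseries_ge0.
    rewrite inE mul1r => -[Dy /= hy].
    have hV : 1 <= (h y)^-1 by rewrite invf_ge1// h1.
    have [i /andP[i1 i2]] := pow4_sandwich hV.
    apply: le_trans (le_nneseries_term i _) => //.
    rewrite /u lee_fin indicE mem_set ?mulr1; last first.
      by split => //=; rewrite -[leLHS]invrK lef_pV2// posrE ?invr_gt0 ?exprn_gt0.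
    rewrite -sqrtrV ?(ltW hy)// -exprS -sqrt_pow4.
    by rewrite ler_wsqrtr// ltW.
rewrite integral_nneseries//.
apply: (@le_trans _ _ (\sum_(0 <= i <oo) (2 * C * 2^-1 ^+ i)%:E)%E).
  apply: lee_nneseries => [i _ _|i _]; first exact: integral_ge0.
  rewrite /u; under eq_integral do rewrite EFinM.
  rewrite ge0_integralZl//; last first.
    by apply/measurable_EFinP; exact: measurable_indic.
  rewrite integral_indic// setIT.
  apply: (@le_trans _ _ ((2 * 2 ^+ i)%:E * (C * 4 ^- i)%:E)%E).
    apply: lee_wpmul2l; first by rewrite lee_fin mulr_ge0// exprn_ge0.
    by apply: slab; rewrite invr_ge0 exprn_ge0.
  rewrite -EFinM lee_fin exprVn (_ : 4 ^+ i = 2 ^+ i * 2 ^+ i); last first.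
    by rewrite -exprMn; congr (_ ^+ _); ring.
  rewrite le_eqVlt; apply/orP; left; apply/eqP; field.
  by rewrite expf_neq0.
apply: le_trans (nneseries_geometric_le _ _) _.
- by rewrite mulr_ge0.
- by apply/andP; split; lra.
- by rewrite lee_fin le_eqVlt; apply/orP; left; apply/eqP; field.
Qed.

Lemma measurable_lt_fun d (T : measurableType d) (R : realType) (f g : T -> R) :
  measurable_fun setT f -> measurable_fun setT g ->
  measurable [set x | f x < g x].
Proof.
move=> mf mg; rewrite (_ : [set x | f x < g x] = ~` [set x | g x <= f x]).
  by apply: measurableC; exact: measurable_le_fun.
by apply/seteqP; split => y /=; [rewrite ltNge => /negP|
  move/negP; rewrite -ltNge].
Qed.

Lemma measurable_preimage d1 d2 (X : measurableType d1) (Y : measurableType d2)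
    (f : X -> Y) (A : set Y) :
  measurable_fun setT f -> measurable A -> measurable (f @^-1` A).
Proof. by move=> mf mA; rewrite -[X in measurable X]setTI; exact: mf. Qed.

(** A single term suffices, the one with [4^i <= b / h < 4^(i+1)]: there [sqrt (h / b) <= 2^-i] and
    [b^-n <= (4^i * h)^-n]. The condition kept in the series is an upper bound on [b], the form in
    which volumes are estimated. *)
Lemma kernel_le_series (R : realType) (b h : R) n : 0 < h -> h <= b ->
  ((Num.sqrt (h / b) * b ^- n)%:E <=
    \sum_(0 <= i <oo)
      (2^-1 ^+ i * (4 ^+ i * h) ^- n * (b <= 4 ^+ i.+1 * h)%R%:R)%:E)%E.
Proof.
move=> h0 hb; have b0 : 0 < b by apply: lt_le_trans hb.
have bh : 1 <= b / h by rewrite ler_pdivlMr// mul1r.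
have [i /andP[i1 i2]] := pow4_sandwich bh.
apply: le_trans (le_nneseries_term i _) => [|j]; last first.
  by rewrite lee_fin !mulr_ge0// ?invr_ge0 ?exprn_ge0// mulr_ge0 ?exprn_ge0// ltW.
move: i1 i2; rewrite ler_pdivlMr// ltr_pdivrMr// => i1 /ltW i2.
rewrite i2 mulr1 lee_fin; apply: ler_pM;
  rewrite ?sqrtr_ge0 ?invr_ge0 ?exprn_ge0 ?(ltW b0)//.
  rewrite exprVn -sqrt_pow4 -sqrtrV ?exprn_ge0// ler_wsqrtr//.
  by rewrite ler_pdivrMr// ler_pdivlMl ?exprn_gt0.
rewrite lef_pV2 ?posrE ?exprn_gt0 ?mulr_gt0 ?exprn_gt0//.
by apply: lerXn2r => //; rewrite nnegrE ?mulr_ge0 ?exprn_ge0// ltW.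
Qed.

(* An abstract form of the estimate for one pair of cells: [x] ranges over [E],
   [y] over [D], and [Q (x, z)] records what is known of [z = b x *: y + a x]. *)
Section dilation.
Context (R : realType) (n : nat) (E D : set 'rV[R]_n) (b h : 'rV[R]_n -> R)
  (a : 'rV[R]_n -> 'rV[R]_n) (Q : set ('rV[R]_n * 'rV[R]_n)) (C : R).
Hypotheses (mE : measurable E) (mD : measurable D) (mQ : measurable Q).
Hypotheses (mb : measurable_fun setT b) (mh : measurable_fun setT h)
  (ma : measurable_fun setT a) (C0 : 0 <= C).
Local Notation mu := (lebesgue_rv R n).
Hypothesis slab : forall t : R, 0 <= t ->
  (mu (D `&` [set y | (h y <= t)%R]) <= (C * t)%:E)%E.
Hypothesis h1 : forall y, D y -> h y <= 1.
Hypothesis b0 : forall x, E x -> 0 < b x.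
Hypothesis hQ : forall x y, E x -> D y ->
  h (b x *: y + a x) = b x * h y /\ Q (x, b x *: y + a x).
Hypothesis vol : forall z (t : R), 0 < t ->
  (mu [set x | [/\ E x, Q (x, z) & (b x <= t)%R]] <= (C * t ^+ n)%:E)%E.

Let W i : set ('rV[R]_n * 'rV[R]_n) :=
  [set p | [/\ E p.1, Q p, 0 < h p.2 & b p.1 <= 4 ^+ i.+1 * h p.2]].
Let D' : set 'rV[R]_n := D `&` [set y | 0 < h y].
(** The term of index [i] in the series of [kernel_le_series] at [b x] and [h z], restricted to the
    pairs allowed by [E] and [Q]. *)
Let G i (p : 'rV[R]_n * 'rV[R]_n) : R :=
  2^-1 ^+ i * (4 ^+ i * h p.2) ^- n * \1_(W i) p.

Let mh2 : measurable_fun setT (fun p : 'rV[R]_n * 'rV[R]_n => h p.2).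
Proof. by apply: measurableT_comp => //; exact: measurable_snd. Qed.

Let mb1 : measurable_fun setT (fun p : 'rV[R]_n * 'rV[R]_n => b p.1).
Proof. by apply: measurableT_comp => //; exact: measurable_fst. Qed.

Let mW i : measurable (W i).
Proof.
have -> : W i = (fst @^-1` E) `&` Q `&` [set p | 0 < h p.2] `&`
    [set p | b p.1 <= 4 ^+ i.+1 * h p.2].
  by apply/seteqP; split => p /=; [move=> []|move=> [[[]]]].
apply: measurableI; last first.
  by apply: measurable_le_fun => //; exact: measurable_funM.
apply: measurableI; last exact: measurable_lt_fun.
by apply: measurableI => //; apply: measurable_preimage.
Qed.

Let mD' : measurable D'.
Proof. by apply: measurableI => //; exact: measurable_lt_fun. Qed.

Let G0 i p : 0 <= G i p.
Proof.
rewrite /G indicE; case: (boolP (_ \in _)) => [|_]; last by rewrite mulr0.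
rewrite inE mulr1 => -[_ _ /ltW hp _].
by rewrite mulr_ge0 ?invr_ge0 ?exprn_ge0// mulr_ge0 ?exprn_ge0.
Qed.

Let mG i : measurable_fun setT (G i).
Proof.
apply: measurable_funM; last exact: measurable_indic.
apply: measurable_funM => //; apply: (measurableT_comp (@measurable_invr R)).
by apply: measurable_funX; exact: measurable_funM.
Qed.

(** By [vol] at [t = 4^(i+1) * h z], the layer has measure at most [C * (4^(i+1) * h z)^n]. The
    powers of [h z] cancel against the kernel, which makes the bound uniform in [z]. *)
Let G_vol i z : (\int[mu]_x (G i (x, z))%:E <= (4 ^+ n * C * 2^-1 ^+ i)%:E)%E.
Proof.
have [hz|hz] := ltP 0 (h z); last first.
  rewrite (_ : (\int[mu]_x (G i (x, z))%:E)%E = 0%E).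
    by rewrite lee_fin !mulr_ge0// ?exprn_ge0// invr_ge0.
  apply: integral0_eq => x _; rewrite /G indicE memNset ?mulr0//.
  by move=> [_ _ /=]; rewrite ltNge hz.
pose S := [set x | [/\ E x, Q (x, z) & (b x <= 4 ^+ i.+1 * h z)%R]].
have mS : measurable S.
  have -> : S = (fun x => (x, z)) @^-1` W i.
    by apply/seteqP; split => x /= []; [split|move=> ? ? _ ?; split].
  by apply: measurable_preimage => //; exact: measurable_fun_pair.
rewrite (_ : (\int[mu]_x _)%E =
    (\int[mu]_x ((2^-1 ^+ i * (4 ^+ i * h z) ^- n)%:E * (\1_S x)%:E))%E);
      last first.
  apply: eq_integral => x _; rewrite -EFinM /G; congr (_ * _)%:E.
  rewrite !indicE; congr (nat_of_bool _)%:R; apply/idP/idP; rewrite !inE.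
    by move=> [].
  by move=> [].
have k0 : 0 <= 2^-1 ^+ i * (4 ^+ i * h z) ^- n.
  by rewrite mulr_ge0 ?invr_ge0 ?exprn_ge0// mulr_ge0 ?exprn_ge0// ltW.
rewrite ge0_integralZl//; last first.
  by apply/measurable_EFinP; exact: measurable_indic.
rewrite integral_indic// setIT.
apply: le_trans (lee_wpmul2l _ (vol z _)) _ => //.
  by rewrite mulr_gt0// exprn_gt0.
rewrite -EFinM lee_fin le_eqVlt; apply/orP; left; apply/eqP.
rewrite exprS -mulrA [(4 * _) ^+ n]exprMn.
field.
by rewrite expf_neq0// mulf_neq0 ?expf_neq0// gt_eqF.
Qed.

Let mGv (v : 'rV[R]_n -> R) i : measurable_fun setT v ->
  measurable_fun setT (fun p => (G i p * v p.2 ^+ 2)%:E).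
Proof.
move=> mv; apply/measurable_EFinP; apply: measurable_funM => //.
by apply: measurable_funX; apply: measurableT_comp => //; exact: measurable_snd.
Qed.

Let Gv0 (v : 'rV[R]_n -> R) i p : (0 <= (G i p * v p.2 ^+ 2)%:E)%E.
Proof. by rewrite lee_fin mulr_ge0// sqr_ge0. Qed.

(** Tonelli puts the [x] integral inside; [G_vol] bounds it layer by layer, and the geometric series
    contributes the factor 2. *)
Let integral_kernel (v : 'rV[R]_n -> R) : measurable_fun setT v ->
  (\int[mu]_x \int[mu]_z \sum_(0 <= i <oo) (G i (x, z) * v z ^+ 2)%:E <=
   (2 * 4 ^+ n * C)%:E * \int[mu]_z (v z ^+ 2)%:E)%E.
Proof.
move=> mv.
pose f p := (\sum_(0 <= i <oo) (G i p * v p.2 ^+ 2)%:E)%E.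
have mf : measurable_fun setT f.
  apply: ge0_emeasurable_sum => [i p _ _|i _]; first exact: Gv0.
  exact: mGv.
have f0 p : (0 <= f p)%E by apply: nneseries_ge0.
rewrite (fubini_tonelli (m1 := mu) (m2 := mu) f)//.
rewrite -ge0_integralZl//; last 3 first.
- by apply/measurable_EFinP; exact: measurable_funX.
- by move=> z _; rewrite lee_fin sqr_ge0.
- by rewrite lee_fin !mulr_ge0// exprn_ge0.
apply: ge0_le_integral => //.
- by move=> z _; apply: integral_ge0.
- exact: measurable_fun_fubini_tonelli_G.
- apply: measurable_funeM; apply/measurable_EFinP; exact: measurable_funX.
move=> z _; rewrite /f /= integral_nneseries//; last first.
  by move=> i; exact: (measurableT_comp (mGv i mv) (pair2_measurable z)).
apply: (@le_trans _ _ (\sum_(0 <= i <oo)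
    (v z ^+ 2 * (4 ^+ n * C) * 2^-1 ^+ i)%:E)%E).
  apply: lee_nneseries => [i _ _|i _]; first exact: integral_ge0.
  under eq_integral do rewrite mulrC EFinM.
  rewrite ge0_integralZl//; last 3 first.
  - apply/measurable_EFinP.
    exact: (measurableT_comp (mG i) (pair2_measurable z)).
  - by move=> x _; rewrite lee_fin.
  - by rewrite lee_fin sqr_ge0.
  rewrite -mulrA [X in (_ <= X)%E]EFinM; apply: lee_wpmul2l => //.
  by rewrite lee_fin sqr_ge0.
apply: le_trans (nneseries_geometric_le _ _) _.
- by apply: mulr_ge0; [exact: sqr_ge0|rewrite mulr_ge0// exprn_ge0].
- by apply/andP; split; lra.
- by rewrite -EFinM lee_fin le_eqVlt; apply/orP; left; apply/eqP; field.
Qed.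

(** Substituting [z = b x *: y + a x] turns the weight [sqrt (h y)] into [sqrt (h z / b x)] and
    produces the Jacobian factor [(b x)^-n]; [kernel_le_series] bounds their product. *)
Let integral_weight (x : 'rV[R]_n) (v : 'rV[R]_n -> R) :
  E x -> measurable_fun setT v ->
  (\int[mu]_y (\1_D' y * Num.sqrt (h y) * v (b x *: y + a x) ^+ 2)%:E <=
   \int[mu]_z \sum_(0 <= i <oo) (G i (x, z) * v z ^+ 2)%:E)%E.
Proof.
move=> Ex mv.
(* [S] contains the image of [D'], because [h z = b x * h y] with [0 < h y <= 1]. *)
pose S := [set z | Q (x, z) /\ 0 < h z <= b x].
have mS : measurable S.
  have -> : S = (pair x @^-1` Q) `&` [set z | 0 < h z] `&` [set z | h z <= b x].
    by apply/seteqP; split => z /=; [move=> [? /andP[]]|move=> [[? ?] ?];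
      split => //; apply/andP].
  apply: measurableI; last exact: measurable_le_fun.
  apply: measurableI; last exact: measurable_lt_fun.
  apply: measurable_preimage => //; exact: pair1_measurable.
pose F z : \bar R := (\1_S z * Num.sqrt (h z / b x) * v z ^+ 2)%:E.
have F0 z : (0 <= F z)%E by
  rewrite lee_fin mulr_ge0 ?sqr_ge0// mulr_ge0 ?sqrtr_ge0.
have mF : measurable_fun setT F.
  apply/measurable_EFinP; apply: measurable_funM; last exact: measurable_funX.
  apply: measurable_funM; first exact: measurable_indic.
  apply: (measurableT_comp (@measurable_sqrtr R)).
  exact: measurable_funM.
have mZ : measurable_fun setT (fun y : 'rV[R]_n => b x *: y + a x).
  exact: measurable_rv_addZ.
apply: (@le_trans _ _ (\int[mu]_y F (b x *: y + a x)%R)%E).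
  apply: ge0_le_integral => //.
  - by move=> y _; rewrite lee_fin mulr_ge0 ?sqr_ge0// mulr_ge0 ?sqrtr_ge0.
  - apply/measurable_EFinP; apply: measurable_funM; last first.
      by apply: measurable_funX; exact: measurableT_comp.
    apply: measurable_funM; first exact: measurable_indic.
    exact: (measurableT_comp (@measurable_sqrtr R)).
  - exact: measurableT_comp.
  move=> y _; rewrite indicE; case: (boolP (_ \in _)) => [|_]; last first.
    by rewrite !mul0r.
  rewrite inE => -[Dy /= hy]; have [hE Qy] := hQ Ex Dy.
  have bx := b0 Ex.
  rewrite /F indicE mem_set ?mul1r; last first.
    split => //; rewrite hE mulr_gt0//= ler_piMr ?(ltW bx)//; exact: h1.
  by rewrite hE mulrAC divff ?gt_eqF// mul1r.
rewrite integral_affine_rv//; last exact: b0.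
rewrite -ge0_integralZl//; last by rewrite lee_fin invr_ge0 exprn_ge0// ltW// b0.
apply: ge0_le_integral => //.
- by move=> z _; rewrite mule_ge0// lee_fin invr_ge0 exprn_ge0// ltW// b0.
- exact: measurable_funeM.
- apply: ge0_emeasurable_sum => [i p _ _|i _]; first exact: Gv0.
  by have := (measurableT_comp (mGv i mv) (pair1_measurable x)).
move=> z _; rewrite /F indicE; case: (boolP (_ \in _)) => [|_]; last first.
  by rewrite !mul0r mule0 nneseries_ge0.
rewrite inE => -[Qz /andP[hz hzb]].
rewrite mul1r -EFinM mulrA mulrC [_ ^- n * _]mulrC EFinM.
have v0 : (0 <= (v z ^+ 2)%:E)%E by rewrite lee_fin sqr_ge0.
apply: le_trans (lee_wpmul2l v0 (kernel_le_series n hz hzb)) _.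
rewrite -nneseriesZl; last first.
  move=> i _; rewrite lee_fin !mulr_ge0// ?invr_ge0 ?exprn_ge0//.
  by rewrite mulr_ge0 ?exprn_ge0// ltW.
apply: lee_nneseries => [i _ _|i _].
  rewrite -EFinM lee_fin mulr_ge0 ?sqr_ge0// !mulr_ge0// ?invr_ge0 ?exprn_ge0//.
  by rewrite mulr_ge0 ?exprn_ge0// ltW.
rewrite -EFinM lee_fin mulrC ler_wpM2r ?sqr_ge0// /G ler_wpM2l//.
  by rewrite !mulr_ge0// ?invr_ge0 ?exprn_ge0// mulr_ge0 ?exprn_ge0// ltW.
case: (boolP (b x <= _)) => bz; last by rewrite ler0n.
by rewrite indicE mem_set.
Qed.

(** Weighted Cauchy-Schwarz: the integrand is split as [h^(-1/4)] times [h^(1/4) * |v|]. The square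
    of the first factor integrates to at most [4 * C]; that of the second is handled by
    [integral_weight]. *)
Let integral_sqr (x : 'rV[R]_n) (v : 'rV[R]_n -> R) :
  E x -> measurable_fun setT v ->
  ((\int[mu]_y (\1_D y * `|v (b x *: y + a x)|)%:E) ^+ 2 <=
   (4 * C)%:E * \int[mu]_z \sum_(0 <= i <oo) (G i (x, z) * v z ^+ 2)%:E)%E.
Proof.
move=> Ex mv.
have mvZ : measurable_fun setT (fun y : 'rV[R]_n => v (b x *: y + a x)).
  by apply: measurableT_comp => //; exact: measurable_rv_addZ.
have mD1 : measurable_fun setT (\1_D : _ -> R) by exact: measurable_indic.
have mD1' : measurable_fun setT (\1_D' : _ -> R) by exact: measurable_indic.
(* The fourth root, so that [s^2] is the weight [sqrt h]. *)
pose s y := Num.sqrt (Num.sqrt (h y)).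
have ms : measurable_fun setT s.
  by apply: (measurableT_comp (@measurable_sqrtr R));
    exact: (measurableT_comp (@measurable_sqrtr R)).
pose p y := \1_D' y * (s y)^-1.
pose q y := \1_D' y * s y * v (b x *: y + a x).
have mp : measurable_fun setT p.
  by apply: measurable_funM => //; exact: (measurableT_comp (@measurable_invr R)).
have mq : measurable_fun setT q by do 2 apply: measurable_funM => //.
have s0 y : 0 < h y -> 0 < s y by move=> hy; rewrite !sqrtr_gt0.
have s2 y : s y ^+ 2 = Num.sqrt (h y) by rewrite sqr_sqrtr// sqrtr_ge0.
have i2 y : (\1_D' y) ^+ 2 = \1_D' y :> R.
  by rewrite indicE; case: (_ \in _); rewrite ?expr1n ?expr0n.
have := cauchy_schwarz_sqr mu mp mq.
have -> : (\int[mu]_y `|p y * q y|%:E =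
    \int[mu]_y (\1_D y * `|v (b x *: y + a x)|)%:E)%E.
  (* The integrands differ at most on the part of [D] where [h <= 0], a null set by [slab] at
     [t = 0]. *)
  apply: ge0_ae_eq_integral => //.
  - apply/measurable_EFinP; apply: measurableT_comp => //; exact: measurable_funM.
  - by apply/measurable_EFinP; apply: measurable_funM => //;
    exact: measurableT_comp.
  exists (D `&` [set y | h y <= 0]); split.
  - by apply: measurableI => //; exact: measurable_le_fun.
  - by apply/eqP; rewrite eq_le measure_ge0 andbT; have := slab (lexx 0);
    rewrite mulr0.
  move=> y /= /not_implyP[_ yP].
  rewrite /p /q in yP.
  case: (pselect (D y)) => [Dy|Dy]; last first.
    by exfalso; apply: yP; rewrite !indicE !memNset ?mul0r ?normr0// => -[].
  split => //=; rewrite leNgt; apply/negP => hy; apply: yP.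
  rewrite !indicE !mem_set// !mul1r mulrA mulVf ?gt_eqF ?s0// mul1r//.
move=> CS; apply: le_trans CS _; apply: lee_pmul => //.
- by apply: integral_ge0 => y _; rewrite lee_fin sqr_ge0.
- by apply: integral_ge0 => y _; rewrite lee_fin sqr_ge0.
- apply: le_trans (integral_inv_sqrt_le mD mh C0 slab h1).
  rewrite le_eqVlt; apply/orP; left; apply/eqP; apply: eq_integral => y _.
  by rewrite /p exprMn exprVn s2 i2.
- apply: le_trans (integral_weight Ex mv).
  rewrite le_eqVlt; apply/orP; left; apply/eqP; apply: eq_integral => y _.
  by rewrite /q !exprMn s2 i2.
Qed.

(* The factor [8 * 4^n * C^2] is [4 C], from the weight [h^(-1/2)], times
   [2 * 4^n * C], from the layers of the kernel. *)
Lemma dilation_L2_bound (v : 'rV[R]_n -> R) : measurable_fun setT v ->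
  (\int[mu]_x ((\1_E x)%:E *
      (\int[mu]_y (\1_D y * `|v (b x *: y + a x)|)%:E) ^+ 2) <=
   (8 * 4 ^+ n * C ^+ 2)%:E * \int[mu]_z (v z ^+ 2)%:E)%E.
Proof.
move=> mv.
pose K x := (\int[mu]_z \sum_(0 <= i <oo) (G i (x, z) * v z ^+ 2)%:E)%E.
pose f p := (\sum_(0 <= i <oo) (G i p * v p.2 ^+ 2)%:E)%E.
have mf : measurable_fun setT f.
  apply: ge0_emeasurable_sum => [i p _ _|i _]; first exact: Gv0.
  exact: mGv.
have f0 p : (0 <= f p)%E by apply: nneseries_ge0.
have mK : measurable_fun setT K.
  exact: (@measurable_fun_fubini_tonelli_F _ _ _ _ _ mu f).
have K0 x : (0 <= K x)%E by apply: integral_ge0 => z _; exact: (f0 (x, z)).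
have mS : measurable_fun setT
    (fun x => \int[mu]_y (\1_D y * `|v (b x *: y + a x)|)%:E)%E.
  apply: (@measurable_fun_fubini_tonelli_F _ _ _ _ _ mu
    (fun p => (\1_D p.2 * `|v (b p.1 *: p.2 + a p.1)|)%:E)) => [|p]; last first.
    by rewrite lee_fin mulr_ge0.
  apply/measurable_EFinP; apply: measurable_funM.
    by apply: measurableT_comp; [exact: measurable_indic|exact: measurable_snd].
  apply: measurableT_comp => //; apply: measurableT_comp => //.
  by apply: measurable_rv_addZ => //; apply: measurableT_comp => //;
    exact: measurable_fst.
apply: (@le_trans _ _ (\int[mu]_x ((4 * C)%:E * K x))%E).
  apply: ge0_le_integral => //.
  - by move=> x _; rewrite mule_ge0 ?lee_fin// expe_ge0// integral_ge0// => y _;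
    rewrite lee_fin mulr_ge0.
  - apply: emeasurable_funM.
      by apply/measurable_EFinP; exact: measurable_indic.
    under eq_fun do rewrite expe2.
    exact: emeasurable_funM.
  - exact: measurable_funeM.
  move=> x _; rewrite indicE; case: (boolP (_ \in _)) => [|_]; last first.
    by rewrite mul0e mule_ge0// lee_fin mulr_ge0.
  by rewrite inE mul1e => Ex; exact: integral_sqr.
rewrite ge0_integralZl//; last by rewrite lee_fin mulr_ge0.
apply: le_trans (lee_wpmul2l _ (integral_kernel mv)) _.
  by rewrite lee_fin mulr_ge0.
rewrite muleA -EFinM le_eqVlt; apply/orP; left; apply/eqP.
by congr (_%:E * _)%E; ring.
Qed.

End dilation.

(** * Barycentric coordinates *)

(** The sigma-algebra is generated by coordinates, so an open set is written as the countable union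
    of the boxes it contains that have rational centre and radius [1 / (k+1)]. *)
Lemma open_measurable_rv (R : realType) n (U : set 'rV[R]_n) :
  open U -> measurable U.
Proof.
move=> oU.
pose B (p : 'rV[rat]_n * nat) : set 'rV[R]_n :=
  box (map_mx ratr p.1) p.2.+1%:R^-1.
pose F p := if pselect (B p `<=` U) then B p else set0.
have -> : U = \bigcup_p F p.
  apply/seteqP; split => [x Ux|x [p _]]; last first.
    by rewrite /F; case: pselect => // BU /BU.
  have /nbhs_ballP[e /= e0 xeU] : nbhs x U by exact: open_nbhs_nbhs.
  (* Twice the radius: a box containing [x] is then contained in the ball of radius [e] about
     [x]. *)
  have [k ke] : exists k, 2 * (k.+1%:R : R)^-1 < e.
    have e20 : 0 <= 2 / e by rewrite divr_ge0// ltW.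
    exists (Num.Def.archi_bound (2 / e)).
    rewrite ltr_pdivrMr// -ltr_pdivrMl// mulrC.
    by apply: lt_le_trans (archi_boundP e20) _; rewrite ler_nat.
  have [q qP] : exists q : 'rV[rat]_n, forall i,
      `|x ord0 i - ratr (q ord0 i)| <= (k.+1%:R : R)^-1.
    have /choice[q qP] : forall i, exists q : rat,
        `|x ord0 i - ratr q| <= (k.+1%:R : R)^-1.
      move=> i; have k0 : 0 < (k.+1%:R : R)^-1 by rewrite invr_gt0.
      have [|q] :=
        @rat_in_itvoo R (x ord0 i - k.+1%:R^-1) (x ord0 i + k.+1%:R^-1).
        by rewrite ltrBlDr -addrA ltrDl addr_gt0.
      rewrite in_itv/= => /andP[q1 q2]; exists q.
      by rewrite distrC ler_distl !ltW.
    by exists (\row_i q i) => i; rewrite mxE.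
  exists (q, k) => //; rewrite /F; case: pselect => [BU|nBU] /=.
    by move=> i /=; rewrite mxE.
  apply: nBU => y yB; apply: xeU; split => // i j.
  rewrite (ord1 i) /ball/=; apply: le_lt_trans ke.
  have := yB j; rewrite /= mxE => h1; have := qP j => h2.
  apply: le_trans (ler_distD (ratr (q ord0 j)) _ _) _.
  rewrite [X in _ + X]distrC mulr2n mulrDl mul1r; exact: lerD.
apply: countable_bigcupT_measurable; first exact: countableP.
move=> p; rewrite /F; case: pselect => BU /=; last exact: measurable0.
exact: measurable_box.
Qed.

Lemma affine_dilate (R : realType) n (V : finType) (g : {set V})
    (x : V -> 'rV[R]_n) (c : V -> R) (f : 'rV[R]_n -> R) y : affine f ->
  f ((1 - \sum_(j in g) c j) *: y + \sum_(j in g) c j *: x j) =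
  (1 - \sum_(j in g) c j) * f y + \sum_(j in g) c j * f (x j).
Proof.
move=> [w [k fE]].
have Lsum : ((\sum_(j in g) c j *: x j) *m w) ord0 ord0 =
    \sum_(j in g) c j * (x j *m w) ord0 ord0.
  rewrite mulmx_suml summxE; apply: eq_bigr => j _.
  by rewrite -scalemxAl [LHS]mxE.
have Ladd r z : ((r *: y + z) *m w) ord0 ord0 =
    r * (y *m w) ord0 ord0 + (z *m w) ord0 ord0.
  by rewrite mulmxDl -scalemxAl [LHS]mxE [X in X + _]mxE.
rewrite !fE Ladd Lsum.
under [X in _ = _ + X]eq_bigr do rewrite fE mulrDr.
rewrite big_split/= -mulr_suml; ring.
Qed.

Lemma affine_comb (R : realType) n (V : finType) (K : {set V})
    (x : V -> 'rV[R]_n) (c : V -> R) (f : 'rV[R]_n -> R) : affine f ->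
  \sum_(j in K) c j = 1 ->
  f (\sum_(j in K) c j *: x j) = \sum_(j in K) c j * f (x j).
Proof.
move=> af c1; have := affine_dilate K x c 0 af.
by rewrite c1 subrr scale0r add0r mul0r add0r.
Qed.

Lemma affine_sum (R : realType) n (V : finType) (g : {set V})
    (f : V -> 'rV[R]_n -> R) : (forall j, affine (f j)) ->
  affine (fun y => 1 - \sum_(j in g) f j y).
Proof.
move=> /choice[w /choice[c fE]].
exists (- \sum_(j in g) w j), (1 - \sum_(j in g) c j) => y.
rewrite mulmxN mulmx_sumr !mxE summxE.
under eq_bigr do rewrite fE.
by rewrite big_split/= opprD; ring.
Qed.

(** The matrix [M] with rows [(1, x_k)] is square since [#|K| = n.+1], and a row vector in its left
    kernel is an affine dependence, so [M] is invertible. The coordinates of [y] are the entries of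
    [(1, y)] times the inverse of [M], which are affine in [y]. *)
Lemma barycentric_coordinates (R : realType) n (V : finType)
    (x : V -> 'rV[R]_n) (K : {set V}) :
  affinely_independent x K -> #|K| = n.+1 ->
  exists l : V -> 'rV[R]_n -> R, [/\ forall i, affine (l i),
    forall y, \sum_(i in K) l i y = 1 &
    forall y, \sum_(i in K) l i y *: x i = y].
Proof.
move=> indep cK.
have [x0 x0K] : exists x0, x0 \in K by apply/card_gt0P; rewrite cK.
pose e (k : 'I_#|K|) := enum_val k.
pose r (i : V) : 'I_#|K| := enum_rank_in x0K i.
have er k : r (e k) = k by exact: enum_valK_in.
pose M : 'M[R]_(#|K|, 1 + n) :=
  \matrix_(k < #|K|) row_mx (const_mx 1 : 'rV[R]_1) (x (e k)).
have uM (u : 'rV_#|K|) : u *m M =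
    row_mx (const_mx (\sum_k u ord0 k)) (\sum_k u ord0 k *: x (e k)).
  rewrite mulmx_sum_row.
  apply/rowP => j; rewrite summxE mxE.
  under eq_bigr do rewrite rowK !mxE.
  case: splitP => j' _; rewrite ?mxE ?summxE; apply: eq_bigr => k _;
    rewrite ?mxE ?mulr1//.
have fM : row_free M.
  rewrite -kermx_eq0; apply/eqP/row_matrixP => i; rewrite row0.
  have : row i (kermx M) *m M = 0 by rewrite -row_mul mulmx_ker row0.
  move: (row i _) => u; rewrite uM -row_mx0 => /eq_row_mx[s0 sx].
  apply/rowP => k; rewrite mxE -(er k).
  apply: (indep (fun i => u ord0 (r i))); last exact: enum_valP.
    rewrite big_enum_val; under eq_bigr do rewrite er.
    by have := congr1 (fun A : 'rV_1 => A ord0 ord0) s0; rewrite !mxE.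
  by rewrite big_enum_val; under eq_bigr do rewrite er.
have fuM : row_full M by rewrite /row_full (eqP fM) cK.
pose B := pinvmx M.
pose L (y : 'rV[R]_n) : 'rV_#|K| := row_mx (const_mx 1 : 'rV[R]_1) y *m B.
have LM y : L y *m M = row_mx (const_mx 1) y
  by rewrite /L -mulmxA mulVpmx// mulmx1.
exists (fun i y => L y ord0 (r i)); split => [i|y|y].
- exists (col (r i) (dsubmx B)), (usubmx B ord0 (r i)) => y.
  rewrite /L -{1}[B]vsubmxK mul_row_col mxE addrC; congr (_ + _).
    by rewrite [LHS]mxE [RHS]mxE; apply: eq_bigr => k _; rewrite [in RHS]mxE.
  by rewrite mxE big_ord1 mxE mul1r.
- rewrite big_enum_val; under eq_bigr do rewrite er.
  have := LM y; rewrite uM => /eq_row_mx[s0 _].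
  by have := congr1 (fun A : 'rV_1 => A ord0 ord0) s0; rewrite !mxE.
- rewrite big_enum_val; under eq_bigr do rewrite er.
  by have := LM y; rewrite uM => /eq_row_mx[].
Qed.

(** * L2-bounded operators *)

Lemma measurable_fun_fin_bigcup d1 d2 (X : measurableType d1)
    (Y : measurableType d2) (I : choiceType) (D : set I) (F : I -> set X)
    (f : X -> Y) :
  finite_set D -> (forall i, D i -> measurable (F i)) ->
  (forall i, D i -> measurable_fun (F i) f) ->
  measurable_fun (\bigcup_(i in D) F i) f.
Proof.
move=> fD mF mf _ B mB; rewrite setI_bigcupl.
apply: fin_bigcup_measurable => // i Di.
exact: mf Di (mF i Di) B mB.
Qed.

(** For [f] of arbitrary sign, Tonelli is applied separately to the positive and negative parts,
    without integrability. *)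
Lemma measurable_integral_param d1 d2 (X : measurableType d1)
    (Y : measurableType d2) (R : realType)
    (mu : {sigma_finite_measure set Y -> \bar R}) (D : set Y) (f : X * Y -> R) :
  measurable D -> measurable_fun setT f ->
  measurable_fun setT (fun x => \int[mu]_(y in D) (f (x, y))%:E)%E.
Proof.
move=> mD mf.
pose F (p : X * Y) : \bar R := (\1_D p.2 * f p)%:E.
have mF : measurable_fun setT F.
  apply/measurable_EFinP; apply: measurable_funM => //.
  by apply: measurableT_comp; [exact: measurable_indic|exact: measurable_snd].
have FE x : (\int[mu]_(y in D) (f (x, y))%:E =
    \int[mu]_y F^\+ (x, y) - \int[mu]_y F^\- (x, y))%E.
  rewrite integral_mkcond integralE; congr (_ - _)%E; apply: eq_integral => y _.
    rewrite !funeposE /F; congr maxe; rewrite patchE indicE.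
    by case: ifPn => yD; rewrite ?mul1r ?mul0r.
  rewrite !funenegE /F; congr (maxe (- _)%E _); rewrite patchE indicE.
  by case: ifPn => yD; rewrite ?mul1r ?mul0r.
under eq_fun do rewrite FE.
apply: emeasurable_funB.
  apply: (@measurable_fun_fubini_tonelli_F _ _ _ _ _ mu (F^\+)%E) => //.
  exact: measurable_funepos.
apply: (@measurable_fun_fubini_tonelli_F _ _ _ _ _ mu (F^\-)%E) => //.
exact: measurable_funeneg.
Qed.

Lemma expe2D_le (R : realType) (x y : \bar R) : (0 <= x)%E -> (0 <= y)%E ->
  ((x + y) ^+ 2 <= 2%:E * x ^+ 2 + 2%:E * y ^+ 2)%E.
Proof.
move: x y => [x| |] [y| |]//; rewrite ?lee_fin => x0 y0.
- rewrite -subr_ge0.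
  by rewrite (_ : _ - _ = (x - y) ^+ 2) ?sqr_ge0//; ring.
- by rewrite [leRHS](_ : _ = +oo%E) ?leey// !expe2 mulyy gt0_muley.
- by rewrite [leRHS](_ : _ = +oo%E) ?leey// !expe2 mulyy gt0_muley.
- by rewrite [leRHS](_ : _ = +oo%E) ?leey// !expe2 mulyy gt0_muley.
Qed.

Section L2_operators.
Context (R : realType) (n : nat).
Local Notation mu := (lebesgue_rv R n).

(** Serves for majorants of operators. The values are extended reals because integrals of [|v|] may
    be infinite at some points. *)
Definition L2_sublinear (S : ('rV[R]_n -> R) -> 'rV[R]_n -> \bar R) :=
  (forall v, measurable_fun setT v ->
    measurable_fun setT (S v) /\ forall x, 0 <= S v x)%E /\
  exists2 C : R, 0 <= C & forall v, measurable_fun setT v ->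
    (\int[mu]_x (S v x ^+ 2) <= C%:E * \int[mu]_x (v x ^+ 2)%:E)%E.

Lemma L2_sublinear_sum (I : Type) (s : seq I) (P : pred I)
    (S : I -> ('rV[R]_n -> R) -> 'rV[R]_n -> \bar R) :
  (forall i, P i -> L2_sublinear (S i)) ->
  L2_sublinear (fun v x => \sum_(i <- s | P i) S i v x)%E.
Proof.
move=> SP; elim: s => [|i s [m [C C0 CP]]].
  split => [v mv|].
    split => [|x]; last by rewrite big_nil.
    by under eq_fun do rewrite big_nil; exact: measurable_cst.
  exists 0 => // v mv; rewrite mul0e integral0_eq// => x _.
  by rewrite big_nil expe2 mul0e.
have [Pi|Pi] := boolP (P i); last first.
  split => [v mv|].
    have [m1 m2] := m v mv; split => [|x]; last by rewrite big_cons (negPf Pi).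
    by under eq_fun do rewrite big_cons (negPf Pi).
  exists C => // v mv; under eq_integral do rewrite big_cons (negPf Pi).
  exact: CP.
have [mi [Ci Ci0 CiP]] := SP i Pi.
split => [v mv|].
  have [mi1 mi2] := mi v mv; have [m1 m2] := m v mv.
  split => [|x]; last by rewrite big_cons Pi adde_ge0.
  by under eq_fun do rewrite big_cons Pi; exact: emeasurable_funD.
exists (2 * Ci + 2 * C) => [|v mv]; first by rewrite addr_ge0 ?mulr_ge0.
have [mi1 mi2] := mi v mv; have [m1 m2] := m v mv.
have v2 : (0 <= \int[mu]_x (v x ^+ 2)%:E)%E.
  by apply: integral_ge0 => x _; rewrite lee_fin sqr_ge0.
have msq (f : 'rV[R]_n -> \bar R) : measurable_fun setT f ->
    measurable_fun setT (fun x => f x ^+ 2)%E.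
  by move=> mf; under eq_fun do rewrite expe2; exact: emeasurable_funM.
rewrite EFinD ge0_muleDl ?lee_fin ?mulr_ge0// !EFinM -!muleA.
apply: le_trans; last first.
  apply: leeD; (apply: lee_wpmul2l; first by rewrite lee_fin);
    [exact: CiP|exact: CP].
rewrite -!ge0_integralZl//; try exact: msq; try by move=> x _; exact: expe_ge0.
rewrite -ge0_integralD//; last 4 first.
- by move=> x _; rewrite mule_ge0// expe_ge0.
- by apply: measurable_funeM; exact: msq.
- by move=> x _; rewrite mule_ge0// expe_ge0.
- by apply: measurable_funeM; exact: msq.
apply: ge0_le_integral => //.
- move=> x _; apply: expe_ge0; rewrite big_cons Pi; exact: adde_ge0.
- by apply: msq; under eq_fun do rewrite big_cons Pi; exact: emeasurable_funD.
- by apply: emeasurable_funD; apply: measurable_funeM; exact: msq.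
- by move=> x _; rewrite big_cons Pi; exact: expe2D_le.
Qed.

(** [v] ranges over all measurable functions and the integrals may be infinite, so that operators
    compose without any check of integrability. *)
Definition L2_operator (Phi : ('rV[R]_n -> R) -> 'rV[R]_n -> R) :=
  exists2 C : R, 0 <= C & forall v, measurable_fun setT v ->
    measurable_fun setT (Phi v) /\
    (\int[mu]_x (Phi v x ^+ 2)%:E <= C%:E * \int[mu]_x (v x ^+ 2)%:E)%E.

Lemma eq_L2_operator Phi Psi : L2_operator Phi -> (forall v, Phi v = Psi v) ->
  L2_operator Psi.
Proof. by move=> + /funext <-. Qed.

Lemma L2_operator_comp Phi Psi : L2_operator Phi -> L2_operator Psi ->
  L2_operator (fun v => Phi (Psi v)).
Proof.
move=> [C C0 CP] [C' C'0 C'P]; exists (C * C'); first exact: mulr_ge0.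
move=> v mv; have [m' i'] := C'P v mv; have [m i] := CP _ m'.
split => //; apply: le_trans i _.
by rewrite EFinM -muleA; apply: lee_wpmul2l => //; rewrite lee_fin.
Qed.

Lemma L2_operatorB Phi Psi : L2_operator Phi -> L2_operator Psi ->
  L2_operator (fun v => Phi v - Psi v).
Proof.
move=> [C C0 CP] [C' C'0 C'P]; exists (2 * C + 2 * C').
  by rewrite addr_ge0 ?mulr_ge0.
move=> v mv; have [m' i'] := C'P v mv; have [m i] := CP _ mv.
have msq (f : 'rV[R]_n -> R) : measurable_fun setT f ->
    measurable_fun setT (fun x => (f x ^+ 2)%:E).
  by move=> mf; apply/measurable_EFinP; exact: measurable_funX.
split; first exact: measurable_funB.
have v2 : (0 <= \int[mu]_x (v x ^+ 2)%:E)%E.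
  by apply: integral_ge0 => x _; rewrite lee_fin sqr_ge0.
rewrite EFinD ge0_muleDl ?lee_fin ?mulr_ge0// !EFinM -!muleA.
apply: le_trans; last first.
  by apply: leeD; (apply: lee_wpmul2l; first by rewrite lee_fin);
    [exact: i|exact: i'].
have sq0 (f : 'rV[R]_n -> R) x : (0 <= (f x ^+ 2)%:E)%E
  by rewrite lee_fin sqr_ge0.
rewrite -!ge0_integralZl//; try exact: msq.
rewrite -ge0_integralD//; last 4 first.
- by move=> x _; rewrite mule_ge0.
- by apply: measurable_funeM; exact: msq.
- by move=> x _; rewrite mule_ge0.
- by apply: measurable_funeM; exact: msq.
apply: ge0_le_integral => //.
- by apply: msq; exact: measurable_funB.
- by apply: emeasurable_funD; apply: measurable_funeM; exact: msq.
move=> x _; rewrite -!EFinM -EFinD lee_fin -subr_ge0.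
have -> : (Phi v - Psi v) x = Phi v x - Psi v x by [].
by rewrite (_ : _ - _ = (Phi v x + Psi v x) ^+ 2) ?sqr_ge0//; ring.
Qed.

Lemma L2_operatorB_sum (I : Type) (s : seq I) (P : pred I) Phi Psi :
  L2_operator Phi -> (forall i, P i -> L2_operator (Psi i)) ->
  L2_operator (fun v => Phi v - \sum_(i <- s | P i) Psi i v).
Proof.
move=> Phi2 Psi2; elim: s => [|i s IH].
  by apply: eq_L2_operator Phi2 _ => v; rewrite big_nil subr0.
have [Pi|Pi] := boolP (P i).
  apply: eq_L2_operator (L2_operatorB IH (Psi2 i Pi)) _ => v.
  by rewrite big_cons Pi opprD addrA addrAC.
by apply: eq_L2_operator IH _ => v; rewrite big_cons (negPf Pi).
Qed.

Lemma L2_operator_dom S (Phi : ('rV[R]_n -> R) -> 'rV[R]_n -> R) (k : R) :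
  0 <= k -> L2_sublinear S ->
  (forall v, measurable_fun setT v -> measurable_fun setT (Phi v)) ->
  (forall v x, measurable_fun setT v -> `|Phi v x|%:E <= k%:E * S v x)%E ->
  L2_operator Phi.
Proof.
move=> k0 [m [C C0 CP]] mPhi PhiS; exists (k ^+ 2 * C).
  by rewrite mulr_ge0// sqr_ge0.
move=> v mv; split; first exact: mPhi.
have [mS S0] := m v mv.
have mS2 : measurable_fun setT (fun x => S v x ^+ 2)%E.
  by under eq_fun do rewrite expe2; exact: emeasurable_funM.
apply: (@le_trans _ _ (\int[mu]_x ((k ^+ 2)%:E * S v x ^+ 2))%E).
  apply: ge0_le_integral => //.
  - by move=> x _; rewrite lee_fin sqr_ge0.
  - by apply/measurable_EFinP; apply: measurable_funX; exact: mPhi.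
  - exact: measurable_funeM.
  move=> x _; rewrite -real_normK ?num_real// EFin_expe EFin_expe.
  rewrite !expe2 muleACA; apply: lee_pmul; rewrite ?lee_fin//; exact: PhiS.
rewrite ge0_integralZl//; last 2 first.
- by move=> x _; exact: expe_ge0.
- by rewrite lee_fin sqr_ge0.
rewrite [(k ^+ 2 * C)%:E]EFinM -muleA; apply: lee_wpmul2l;
  first by rewrite lee_fin sqr_ge0.
exact: CP.
Qed.

Lemma L2_operator_restrict (D : set 'rV[R]_n) : measurable D ->
  L2_operator (fun v => v \_ D).
Proof.
move=> mD; exists 1 => // v mv; split.
  apply/(measurable_restrictT _ mD); exact: measurable_funTS.
rewrite mul1e; apply: ge0_le_integral => //.
- by move=> x _; rewrite lee_fin sqr_ge0.
- apply/measurable_EFinP; apply: measurable_funX.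
  apply/(measurable_restrictT _ mD); exact: measurable_funTS.
- by apply/measurable_EFinP; exact: measurable_funX.
move=> x _; rewrite lee_fin patchE; case: ifP => // _.
by rewrite expr0n sqr_ge0.
Qed.

End L2_operators.

(** * Pairs of cells *)

Section cell.
Context (R : realType) (n : nat) (V : finType) (x_ : V -> 'rV[R]_n).

(** Barycentric coordinates of [K], extended as affine functions to all of R^n. *)
Definition is_coords (K : {set V}) (l : V -> 'rV[R]_n -> R) :=
  [/\ forall i, affine (l i), forall y, \sum_(i in K) l i y = 1 &
    forall y, \sum_(i in K) l i y *: x_ i = y].

Variables (K : {set V}) (l : V -> 'rV[R]_n -> R).
Hypotheses (indepK : affinely_independent x_ K) (lP : is_coords K l).

Lemma coords_unique (a : V -> R) y : \sum_(i in K) a i = 1 ->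
  \sum_(i in K) a i *: x_ i = y -> forall i, i \in K -> a i = l i y.
Proof.
case: lP => _ l1 lx a1 ax i iK; apply/eqP; rewrite -subr_eq0; apply/eqP.
apply: (indepK (a := fun i => a i - l i y)) iK.
  by rewrite sumrB a1 l1 subrr.
by under eq_bigr do rewrite scalerBl; rewrite sumrB ax lx subrr.
Qed.

Lemma coords_vertex i j : i \in K -> j \in K -> l i (x_ j) = (i == j)%:R.
Proof.
move=> iK jK; rewrite -(@coords_unique (fun i => (i == j)%:R) (x_ j))//.
  rewrite (bigD1 j)//= eqxx big1 ?addr0// => k /andP[_ /negPf ->] //.
rewrite (bigD1 j)//= eqxx scale1r big1 ?addr0// => k /andP[_ /negPf ->].
by rewrite scale0r.
Qed.

(** Replaces the convex hull by finitely many affine inequalities, from which measurability can be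
    read off. *)
Lemma simplex_coords : simplex x_ K = [set y | forall i, i \in K -> 0 <= l i y].
Proof.
case: (lP) => _ l1 lx.
apply/seteqP; split => [y [a [a0 a1 ay]] i iK|y yK].
  by rewrite -(coords_unique a1 (esym ay)).
exists (fun i => if i \in K then l i y else 0); split.
- by move=> i; case: ifPn => // /yK.
- by rewrite -[RHS](l1 y); apply: eq_bigr => i ->.
- by rewrite -[LHS](lx y); apply: eq_bigr => i ->.
Qed.

Lemma measurable_coords i : measurable_fun setT (l i).
Proof. by case: lP => al _ _; exact: affine_measurable. Qed.

Lemma measurable_simplex : measurable (simplex x_ K).
Proof.
rewrite simplex_coords.
have -> : [set y | forall i, i \in K -> 0 <= l i y] =
    \bigcap_(i in [set` K]) [set y | 0 <= l i y].
  by apply/seteqP; split => y yK i /yK.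
apply: fin_bigcap_measurable; first exact: finite_finset.
by move=> i _; apply: measurable_le_fun => //; exact: measurable_coords.
Qed.

Lemma coords_le1 y i : simplex x_ K y -> i \in K -> 0 <= l i y <= 1.
Proof.
rewrite simplex_coords => yK iK; rewrite yK//=.
case: lP => _ l1 _; rewrite -(l1 y) (bigD1 i)//= lerDl sumr_ge0// => j /andP[+ _].
exact: yK.
Qed.

End cell.

Section cells.
Context (R : realType) (n : nat) (V : finType) (x_ : V -> 'rV[R]_n)
  (K K' g : {set V}) (l l' : V -> 'rV[R]_n -> R).
Hypotheses (indepK : affinely_independent x_ K) (lP : is_coords x_ K l).
Hypotheses (indepK' : affinely_independent x_ K') (lP' : is_coords x_ K' l').
Hypotheses (gK : g \subset K) (gK' : g \subset K') (gneq : g != K').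
Local Notation mu := (lebesgue_rv R n).

(** [g] stands for the vertices retained by a projection, that is [f :\: I]. The argument of [v] in
    the mean is [b x *: y + a x], with [x] in [K] and [y] in [K']. *)
Let b y := 1 - \sum_(j in g) l j y.
Let h y := 1 - \sum_(j in g) l' j y.
Let a y := \sum_(j in g) l j y *: x_ j.
Let E : set 'rV[R]_n := simplex x_ K `&` [set y | 0 < b y].
Let Q : set ('rV[R]_n * 'rV[R]_n) :=
  [set p | 0 <= h p.2 /\ forall j, j \in g -> l j p.1 <= l' j p.2].
(** Bounds each coordinate of any combination of vertices with coefficients in [[-1, 1]]. *)
Let M := \sum_(k : V) \sum_(c < n) `|x_ k ord0 c|.

Let mb : measurable_fun setT b.
Proof. by case: lP => al _ _; apply: affine_measurable; exact: affine_sum. Qed.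

Let ah : affine h. Proof. by case: lP' => al _ _; exact: affine_sum. Qed.

Let mh : measurable_fun setT h. Proof. exact: affine_measurable. Qed.

Let ma : measurable_fun setT a.
Proof.
apply: measurable_fun_rv => i; rewrite /a.
under eq_fun do rewrite summxE -big_filter.
apply: (@measurable_sum _ _ _ _ _ _ (fun j (y : 'rV[R]_n) =>
  (l j y *: x_ j) ord0 i)) => j.
under eq_fun do rewrite mxE.
by apply: measurable_funM => //; exact: measurable_coords lP _.
Qed.

Let mE : measurable E.
Proof.
apply: measurableI; first exact: measurable_simplex lP.
exact: measurable_lt_fun.
Qed.

Let mQ : measurable Q.
Proof.
have -> : Q = [set p | 0 <= h p.2] `&`
    \bigcap_(j in [set` g]) [set p | l j p.1 <= l' j p.2].
  by apply/seteqP; split => p [p1 p2]; split => // j /p2.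
apply: measurableI.
  by apply: measurable_le_fun => //; apply: measurableT_comp.
apply: fin_bigcap_measurable; first exact: finite_finset.
move=> j _; apply: measurable_le_fun.
  apply: measurableT_comp; [exact: measurable_coords lP _|exact: measurable_fst].
apply: measurableT_comp; [exact: measurable_coords lP' _|exact: measurable_snd].
Qed.

Let M0 : 0 <= M. Proof. by do 2 apply: sumr_ge0 => ? _. Qed.

Let coord_bound (c : V -> R) (t : R) (A : {set V}) i : 0 <= t ->
  (forall k, k \in A -> `|c k| <= t) ->
  `|(\sum_(k in A) c k *: x_ k) ord0 i| <= t * M.
Proof.
move=> t0 ct; rewrite summxE; apply: le_trans (ler_norm_sum _ _ _) _.
rewrite /M mulr_sumr big_mkcond/=; apply: ler_sum => k _.
case: ifPn => [kA|_]; last by rewrite mulr_ge0// sumr_ge0.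
rewrite mxE normrM ler_pM ?ct//.
by rewrite (bigD1 i)//= lerDl sumr_ge0.
Qed.

Let h01 y : simplex x_ K' y -> 0 <= h y <= 1.
Proof.
move=> yK'; have l0 i : i \in K' -> 0 <= l' i y.
  by move=> iK; have /andP[] := coords_le1 indepK' lP' yK' iK.
case: lP' => _ l1 _.
have -> : h y = \sum_(i in K' :\: g) l' i y.
  by rewrite /h -(l1 y) (big_setID g)/= (finset.setIidPr gK') addrAC subrr add0r.
apply/andP; split; first by apply: sumr_ge0 => i; rewrite inE => /andP[_ /l0].
rewrite -(l1 y) [leRHS](big_setID g)/= (finset.setIidPr gK') lerDr.
by apply: sumr_ge0 => i ig; apply: l0; exact: (fintype.subsetP gK' _ ig).
Qed.

Let b01 y : simplex x_ K y -> forall k, k \in K :\: g -> 0 <= l k y <= b y.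
Proof.
move=> yK k; rewrite inE => /andP[kg kK].
have l0 i : i \in K -> 0 <= l i y.
  by move=> iK; have /andP[] := coords_le1 indepK lP yK iK.
rewrite l0//=; case: lP => _ l1 _.
have -> : b y = \sum_(i in K :\: g) l i y.
  by rewrite /b -(l1 y) (big_setID g)/= (finset.setIidPr gK) addrAC subrr add0r.
rewrite (bigD1 k) ?inE ?kg//= lerDl sumr_ge0// => i.
by rewrite inE => /andP[/andP[_ /l0]].
Qed.

(** Since [g != K'], some vertex [k0] of [K'] lies outside [g]; there [h] is 1, so [slab_measure]
    applies to [h] in a box containing [K']. *)
Let slab : exists2 C, 0 <= C & forall t : R, 0 <= t ->
  (mu (simplex x_ K' `&` [set y | (h y <= t)%R]) <= (C * t)%:E)%E.
Proof.
have [k0 k0K k0g] : exists2 k0, k0 \in K' & k0 \notin g.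
  apply/fintype.subsetPn; apply: contra gneq => K'g;
    by rewrite finset.eqEsubset gK'.
have h1 : h (x_ k0) = 1.
  rewrite /h big1 ?subr0// => j jg.
  have jK : j \in K' by exact: (fintype.subsetP gK' _ jg).
  rewrite (coords_vertex indepK' lP') //.
  by case: eqVneq k0g => // <-; rewrite jg.
have [w [c hE]] := ah.
have [|C C0 CP] := @slab_measure R n w c M M0.
  by exists (x_ k0); rewrite -hE h1 oner_neq0.
exists C => // t t0; apply: le_trans (CP t t0).
apply: le_measure; rewrite ?inE.
- apply: measurableI; [exact: measurable_simplex lP'|exact: measurable_le_fun].
- apply: measurableI; first exact: measurable_box.
  apply: measurable_le_fun => //; apply: measurableT_comp => //.
  by apply: affine_measurable; exists w, c.
move=> y [yK' /= hy]; split => /=; last first.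
  by rewrite -hE ger0_norm//; have /andP[] := h01 yK'.
move=> i; rewrite mxE subr0; case: lP' => _ _ lx.
rewrite -(lx y) -[leRHS]mul1r; apply: coord_bound => // k kK'.
have /andP[l0 l1] := coords_le1 indepK' lP' yK' kK'.
by rewrite ger0_norm.
Qed.

(** For [j] in [g], [l' j] is affine and takes the values 0 and 1 at the vertices of [g], so
    [l' j z = b x * l' j y + l j x]. Both claims follow, the first by summing over [g]. *)
Let hQ x y : E x -> simplex x_ K' y ->
  h (b x *: y + a x) = b x * h y /\ Q (x, b x *: y + a x).
Proof.
move=> [xK /= bx] yK'.
have l'E j : j \in g -> l' j (b x *: y + a x) = b x * l' j y + l j x.
  move=> jg; case: lP' => al _ _.
  have gK'P i : i \in g -> i \in K'
    by move=> ig; exact: (fintype.subsetP gK' _ ig).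
  rewrite /b /a (affine_dilate _ _ _ _ (al j)); congr (_ + _).
  rewrite (bigD1 j)//= (coords_vertex indepK' lP') ?gK'P// eqxx mulr1.
  rewrite big1 ?addr0// => i /andP[ig ij].
  by rewrite (coords_vertex indepK' lP') ?gK'P// eq_sym (negPf ij) mulr0.
have hE : h (b x *: y + a x) = b x * h y.
  rewrite {1}/h (eq_bigr _ l'E) big_split/= -mulr_sumr /h /b; ring.
split => //; split => [|j jg] /=.
  by rewrite hE mulr_ge0// ?(ltW bx)//; have /andP[] := h01 yK'.
rewrite l'E// lerDr mulr_ge0// ?(ltW bx)//.
by have /andP[] := coords_le1 indepK' lP' yK' (fintype.subsetP gK' _ jg).
Qed.

(** The nonnegative differences [l' j z - l j x], for [j] in [g], add up to [b x - h z <= t], so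
    each [l j x] lies in an interval of length [t] fixed by [z]. The coordinates outside [g] lie in
    [[0, b x]], hence in [[0, t]]. Thus the set fits in a box of radius [t * M] about any of its
    points. *)
Let vol z (t : R) : 0 < t ->
  (mu [set x | [/\ E x, Q (x, z) & (b x <= t)%R]] <=
    ((2 * M) ^+ n * t ^+ n)%:E)%E.
Proof.
move=> t0; set S := [set x | _].
have S_coords y k : S y -> k \in K -> k \in g -> l' k z - t <= l k y <= l' k z.
  move=> [[yK by0] [/= hz Qy] bt] kK kg; rewrite Qy// andbT lerBlDr -lerBlDl.
  apply: le_trans bt; apply: (@le_trans _ _ (b y - h z)); last by rewrite gerBl.
  have -> : b y - h z = \sum_(j in g) (l' j z - l j y).
    rewrite sumrB /b /h; ring.
  by rewrite (bigD1 k)//= lerDl sumr_ge0// => j /andP[jg _]; rewrite subr_ge0 Qy.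
have S_close y y' k : S y -> S y' -> k \in K -> `|l k y - l k y'| <= t.
  move=> Sy Sy' kK; rewrite ler_norml.
  have [kg|kg] := boolP (k \in g).
    have /andP[] := S_coords _ _ Sy kK kg; have /andP[] := S_coords _ _ Sy' kK kg.
    by move=> ? ? ? ?; apply/andP; split; lra.
  have kKg : k \in K :\: g by rewrite inE kg.
  case: Sy Sy' => -[yK _] _ bt [[y'K _] _ bt'].
  have /andP[] := b01 yK kKg; have /andP[] := b01 y'K kKg.
  by move=> ? ? ? ?; apply/andP; split; lra.
have mS : measurable S.
  have -> : S = E `&` ((fun x => (x, z)) @^-1` Q) `&` [set x | b x <= t].
    by apply/seteqP; split => x /= []; [split|move=> [? ?] ?; split].
  apply: measurableI; last exact: measurable_le_fun.
  by apply: measurableI => //; apply: measurable_preimage.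
have [S0|/set0P[x0 Sx0]] := eqVneq S set0.
  by rewrite S0 measure0 lee_fin !mulr_ge0// ?exprn_ge0 ?mulr_ge0// ltW.
apply: (@le_trans _ _ (mu (box x0 (t * M)))).
  apply: le_measure; rewrite ?inE//; first exact: measurable_box.
  move=> y Sy i; have [_ _ lx] := lP.
  rewrite -{1}(lx y) -{1}(lx x0).
  have -> : (\sum_(k in K) l k y *: x_ k) ord0 i -
      (\sum_(k in K) l k x0 *: x_ k) ord0 i =
      (\sum_(k in K) (l k y - l k x0) *: x_ k) ord0 i.
    under [in RHS]eq_bigr do rewrite scalerBl.
    by rewrite sumrB !mxE.
  apply: coord_bound; first exact: ltW.
  by move=> k kK; exact: S_close.
apply: le_trans (lebesgue_box _ _) _; first by rewrite mulr_ge0// ltW.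
by rewrite lee_fin -exprMn mulrCA mulrA [2 * _ * _]mulrC mulrA [t * 2]mulrC
  mulrAC.
Qed.

Lemma cell_dilation_bound : exists2 C : R, 0 <= C &
  forall v : 'rV[R]_n -> R, measurable_fun setT v ->
  (\int[mu]_x ((\1_(simplex x_ K `&`
        [set y | (0 < 1 - \sum_(j in g) l j y)%R]) x)%:E *
      (\int[mu]_y (\1_(simplex x_ K') y *
         `|v ((1 - \sum_(j in g) l j x) *: y +
             \sum_(j in g) l j x *: x_ j)|)%:E) ^+ 2) <=
   C%:E * \int[mu]_z (v z ^+ 2)%:E)%E.
Proof.
have [C1 C10 slabC] := slab.
(* [dilation_L2_bound] takes one constant for both the slab and the volume estimate. *)
pose C := C1 + (2 * M) ^+ n.
have M20 : 0 <= (2 * M) ^+ n by rewrite exprn_ge0// mulr_ge0.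
have C0 : 0 <= C by rewrite addr_ge0.
exists (8 * 4 ^+ n * C ^+ 2).
  by rewrite mulr_ge0 ?sqr_ge0// mulr_ge0// exprn_ge0.
move=> v mv; apply: (@dilation_L2_bound _ _ E (simplex x_ K') b h a Q) => //.
- exact: measurable_simplex lP'.
- move=> t t0; apply: le_trans (slabC t t0) _.
  by rewrite lee_fin ler_wpM2r// lerDl.
- by move=> y /h01 /andP[].
- by move=> x [].
- move=> z t t0; apply: le_trans (vol z t0) _.
  by rewrite lee_fin ler_wpM2r ?exprn_ge0 ?(ltW t0)// lerDr.
Qed.

Lemma cell_L2_sublinear : L2_sublinear (fun v x =>
  ((\1_(simplex x_ K `&` [set y | (0 < 1 - \sum_(j in g) l j y)%R]) x)%:E *
      (\int[mu]_y (\1_(simplex x_ K') y *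
         `|v ((1 - \sum_(j in g) l j x) *: y +
             \sum_(j in g) l j x *: x_ j)|)%:E))%E).
Proof.
split => [v mv|].
  split => [|x]; last first.
    by rewrite mule_ge0 ?lee_fin// integral_ge0// => y _;
      rewrite lee_fin mulr_ge0.
  apply: emeasurable_funM.
    by apply/measurable_EFinP; apply: measurable_indic; exact: mE.
  apply: (@measurable_fun_fubini_tonelli_F _ _ _ _ _ mu
    (fun p => (\1_(simplex x_ K') p.2 * `|v (b p.1 *: p.2 + a p.1)|)%:E)) => [|p].
    apply/measurable_EFinP; apply: measurable_funM.
      apply: measurableT_comp; last exact: measurable_snd.
      by apply: measurable_indic; exact: measurable_simplex lP'.
    apply: measurableT_comp => //; apply: measurableT_comp => //.
    by apply: measurable_rv_addZ => //; apply: measurableT_comp => //;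
      exact: measurable_fst.
  by rewrite lee_fin mulr_ge0.
have [C C0 CP] := cell_dilation_bound; exists C => // v mv.
apply: le_trans (CP v mv); rewrite le_eqVlt; apply/orP; left; apply/eqP.
apply: eq_integral => x _; rewrite !expe2 muleACA; congr (_ * _)%E.
by rewrite -EFinM indicE -natrM mulnb andbb.
Qed.

End cells.

(** * The bubble transform *)

Section bubble_bound.
Context (R : realType) (n : nat) (Om : set 'rV[R]_n) (T : triangulation Om).
Hypothesis oOm : open Om.
Local Notation V := (vtx T).
Local Notation x_ := (@pos R n Om T).
Local Notation mu := (lebesgue_rv R n).
Implicit Types (f g I K : {set V}) (v : 'rV[R]_n -> R).

Let mOm : measurable Om. Proof. exact: open_measurable_rv. Qed.

Lemma exists_cell_coords : exists L : {set V} -> V -> 'rV[R]_n -> R,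
  forall K, K \in cells T -> is_coords x_ K (L K).
Proof.
have /choice[L LP] : forall K, exists l : V -> 'rV[R]_n -> R,
    K \in cells T -> is_coords x_ K l.
  move=> K; have [KT|] := boolP (K \in cells T); last by exists (fun=> cst 0).
  by have [l lP] := barycentric_coordinates (cell_indep KT) (cell_card KT);
    exists l.
by exists L.
Qed.

Lemma bary_cases (i : V) : is_barycentric i (bary i) \/ bary i = cst 0.
Proof.
rewrite /bary; case: xgetP => [l -> lP|_]; [by left|by right].
Qed.

(* The existence of the hat functions is not needed: without a witness [bary i] is
   [0], and then [Cop_eq0] applies. *)
Lemma bary_cell (K : {set V}) (l : V -> 'rV[R]_n -> R) (i : V) y :
  K \in cells T -> is_coords x_ K l -> simplex x_ K y -> bary i y != 0 ->
  i \in K /\ bary i y = l i y.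
Proof.
move=> KT lP yK; have [[_ aff vert]|->] := bary_cases i; last by rewrite eqxx.
have [w [c wE]] := aff K KT.
have [la l1 lx] := lP.
have indep := cell_indep KT.
have vK k : k \in K -> simplex x_ K (x_ k).
  move=> kK; rewrite (simplex_coords indep lP) => j jK.
  by rewrite (coords_vertex indep lP)// ler0n.
(* On [K] the function [bary i] is affine, hence determined by its values at the vertices. *)
have E : bary i y = \sum_(k in K) l k y * (k == i)%:R.
  rewrite wE//; pose h (y : 'rV[R]_n) := (y *m w) ord0 ord0 + c.
  have ah : affine h by exists w, c.
  transitivity (h (\sum_(k in K) l k y *: x_ k)); first by rewrite lx.
  rewrite (affine_comb _ ah)//; apply: eq_bigr => k kK.
  by rewrite -vert wE//; exact: vK.
have [iK|iK] := boolP (i \in K).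
  move=> _; split => //; rewrite E (bigD1 i)//= eqxx mulr1 big1 ?addr0// => k.
  by move=> /andP[_ /negPf ->]; rewrite mulr0.
rewrite E big1 ?eqxx// => k kK; case: eqVneq => [ki|_]; last by rewrite mulr0.
by move: iK; rewrite -ki kK.
Qed.

Lemma closure_cell y : closure Om y -> exists2 K, K \in cells T & simplex x_ K y.
Proof. by rewrite -(cells_cover T) => -[K KT yK]; exists K. Qed.

(** On each of the finitely many cells covering the closure of [Om] the function is affine or
    zero. *)
Lemma bary_measurable (i : V) : measurable_fun Om (bary i).
Proof.
have [L LP] := exists_cell_coords.
have mS K : K \in cells T -> measurable (simplex x_ K).
  by move=> KT; exact: measurable_simplex (cell_indep KT) (LP K KT).
suff : measurable_fun (closure Om) (bary i).
  apply: measurable_funS; last exact: subset_closure.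
  rewrite -(cells_cover T); apply: fin_bigcup_measurable => [|K KT].
    exact: finite_finset.
  exact: mS.
rewrite -(cells_cover T); apply: measurable_fun_fin_bigcup => [||K KT].
- exact: finite_finset.
- by move=> K KT; exact: mS.
have [[_ aff _]|->] := bary_cases i; last exact: measurable_cst.
have [w [c wE]] := aff K KT.
apply: (eq_measurable_fun (fun y : 'rV[R]_n => (y *m w) ord0 ord0 + c)).
  by move=> y; rewrite inE => /wE.
apply: measurable_funTS; apply: affine_measurable; by exists w, c.
Qed.

(* The terms indexed by [I] and [i |: I] cancel. *)
Lemma alternating_sum_cancel (W : zmodType) (f : {set V}) (i : V)
    (F : {set V} -> W) :
  i \in f -> (forall I, i \notin I -> F (i |: I) = - F I) ->
  \sum_(I : {set V} | I \subset f) F I = 0.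
Proof.
move=> fi FE; rewrite (bigID (fun I : {set V} => i \in I))/=.
rewrite (reindex_onto (fun I => i |: I) (fun I => I :\ i))/=; last first.
  by move=> I /andP[_ iI]; rewrite finset.setD1K.
rewrite (eq_bigl (fun I => (I \subset f) && (i \notin I))); last first.
  move=> I; rewrite finset.subUset finset.sub1set fi/= setU11 andbT.
  congr (_ && _); apply/eqP/idP => [<-|iI]; first by rewrite setD11.
  by rewrite setU1K.
rewrite -big_split/= big1// => I /andP[_ iI].
by rewrite FE// addNr.
Qed.

(** Where coordinate [i] is already 0, adding [i] to [I] does not change the projected point; only
    the sign of the term changes. *)
Lemma Cop_eq0 f v y (i : V) : dim f != n -> i \in f -> bary i y = 0 ->
  Cop f v y = 0.
Proof.
move=> /negPf fn fi bi; rewrite /Cop fn patchE; case: ifP => // _.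
apply: (alternating_sum_cancel fi) => I iI.
have -> : proj (i |: I) (bary_at y) = proj I (bary_at y).
  apply/funext => k; rewrite /proj !inE; case: eqVneq => //= ->.
  by rewrite (negPf iI) /bary_at bi.
by rewrite cardsU1 iI exprS mulN1r !mulNr.
Qed.

Lemma dim_cell f : f \in subsimplexes T -> dim f = n -> f \in cells T.
Proof.
rewrite inE => /andP[f0 /existsP[K /andP[KT fK]]] fn.
have cf : #|f| = (dim f).+1 by rewrite /dim prednK// card_gt0.
rewrite fn in cf; suff -> : f = K by [].
by apply/eqP; rewrite eqEcard fK cf (cell_card KT) leqnn.
Qed.

(** For [dim f != n], a nonzero value forces [bary i y != 0] for every vertex [i] of [f] by
    [Cop_eq0], so any cell containing [y] has all of [f] among its vertices. *)
Lemma Cop_support f v y : f \in subsimplexes T ->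
  Cop f v y != 0 -> macroelement f y.
Proof.
move=> fT; have [fn|fn] := eqVneq (dim f) n.
  rewrite /Cop fn eqxx patchE; case: ifP => [_|]; last by rewrite eqxx.
  rewrite patchE; case: ifP => [|]; last by rewrite eqxx.
  rewrite inE => yf _; exists f => //; split => //; exact: dim_cell.
move=> Cy; have yOm : Om y.
  move: Cy; rewrite /Cop patchE; case: ifP => [|]; last by rewrite eqxx.
  by rewrite inE.
have [K KT yK] := closure_cell (subset_closure yOm).
have [L LP] := exists_cell_coords.
exists K => //; split => //; apply/fintype.subsetP => i fi.
have bi : bary i y != 0 by apply: contra Cy => /eqP bi;
  rewrite (Cop_eq0 v fn fi bi).
by have [] := bary_cell KT (LP K KT) yK bi.
Qed.

Lemma measurable_macroelement f : measurable (macroelement f).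
Proof.
have [L LP] := exists_cell_coords.
apply: fin_bigcup_measurable => [|K [KT _]].
  by apply: (@sub_finite_set _ _ [set` cells T]) => [K []//|];
    exact: finite_finset.
exact: measurable_simplex (cell_indep KT) (LP K KT).
Qed.

Lemma Cop_measurable f v : f \in subsimplexes T -> measurable_fun setT v ->
  measurable_fun setT (Cop f v).
Proof.
move=> fT mv.
have [L LP] := exists_cell_coords.
have [fn|/negPf fn] := eqVneq (dim f) n.
  rewrite /Cop fn eqxx.
  have mf : measurable (simplex x_ f).
    have fK := dim_cell fT fn.
    exact: measurable_simplex (cell_indep fK) (LP f fK).
  apply/(measurable_restrictT _ mOm)/measurable_funTS.
  by apply/(measurable_restrictT _ mf)/measurable_funTS.
(* [bary i] is known to be measurable only on [Om]; its extension by zero is measurable everywhere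
   and leaves [Cop] unchanged. *)
pose lam (y : 'rV[R]_n) (i : V) : R := (bary i \_ Om) y.
have mlam i : measurable_fun setT (fun y => lam y i).
  by apply/(measurable_restrictT _ mOm); exact: bary_measurable.
have mproj I i : measurable_fun setT (fun y => proj I (lam y) i).
  by rewrite /proj; case: (i \in I).
have mbfun (F : 'rV[R]_n -> V -> R) : (forall i, measurable_fun setT (F^~ i)) ->
    measurable_fun setT (fun y => bfun f (F y)).
  move=> mF; rewrite /bfun; apply: measurable_funB => //.
  under eq_fun do rewrite -big_filter.
  exact: measurable_sum.
have mAop I : measurable_fun setT (fun y => Aop f v (proj I (lam y))).
  rewrite /Aop; apply: measurable_funM => //.
  apply: (@measurableT_comp _ _ _ _ _ _ (@fine R)) => //.
  apply: (@measurable_integral_param _ _ _ _ _ mu (macroelement f)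
    (fun p => v (p.2 + \sum_(j in f) proj I (lam p.1) j *: (x_ j - p.2)))).
    exact: measurable_macroelement.
  apply: measurableT_comp => //; apply: measurable_fun_rv => i.
  have mp2 : measurable_fun setT (fun p : 'rV[R]_n * 'rV[R]_n => p.2 ord0 i).
    by apply: (measurableT_comp (measurable_coord i)); exact: measurable_snd.
  under eq_fun do rewrite mxE summxE -big_filter.
  apply: measurable_funD => //.
  apply: (@measurable_sum _ _ _ _ _ _ (fun j (p : 'rV[R]_n * 'rV[R]_n) =>
    (proj I (lam p.1) j *: (x_ j - p.2)) ord0 i)) => j.
  under eq_fun do rewrite !mxE.
  apply: measurable_funM; last exact: measurable_funB.
  exact: (measurableT_comp (mproj I j) measurable_fst).
pose H y := \sum_(I : {set V} | I \subset f)
     (-1) ^+ #|I| * (bfun f (lam y) / bfun f (proj I (lam y)))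
       * Aop f v (proj I (lam y)).
have -> : Cop f v = H \_ Om.
  apply/funext => y; rewrite /Cop fn !patchE; case: ifPn => // yOm.
  have -> : bary_at y = lam y by apply/funext => i; rewrite /lam patchE yOm.
  by [].
apply/(measurable_restrictT _ mOm)/measurable_funTS; rewrite /H.
under eq_fun do rewrite -big_filter.
apply: (@measurable_sum _ _ _ _ _ _ (fun I y =>
     (-1) ^+ #|I| * (bfun f (lam y) / bfun f (proj I (lam y)))
       * Aop f v (proj I (lam y)))) => I.
apply: measurable_funM => //; apply: measurable_funM => //.
apply: measurable_funM; first exact: mbfun.
by apply: (measurableT_comp (@measurable_invr R)); exact: mbfun.
Qed.

Lemma sum_proj (W : lmodType R) f I (c : V -> R) (w : V -> W) :
  \sum_(j in f) proj I c j *: w j = \sum_(j in f :\: I) c j *: w j.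
Proof.
rewrite [LHS]big_mkcond [RHS]big_mkcond; apply: eq_bigr => j _.
by rewrite inE /proj; case: (j \in I) => //=; rewrite scale0r; case: ifP.
Qed.

Lemma bfun_proj f I (c : V -> R) :
  bfun f (proj I c) = 1 - \sum_(j in f :\: I) c j.
Proof.
rewrite /bfun; congr (_ - _).
rewrite [LHS]big_mkcond [RHS]big_mkcond; apply: eq_bigr => j _.
by rewrite inE /proj; case: (j \in I) => //=; case: ifP.
Qed.

Lemma abs_Rintegral_macroelement f (F : 'rV[R]_n -> R) : measurable_fun setT F ->
  (`|\int[mu]_(y in macroelement f) F y|%:E <=
   \sum_(K in cells T | f \subset K) \int[mu]_y
     (\1_(simplex x_ K) y * `|F y|)%:E)%E.
Proof.
move=> mF; have [L LP] := exists_cell_coords.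
have mM := measurable_macroelement f.
have mEF : measurable_fun (macroelement f) (EFin \o F).
  by apply: measurable_funTS; exact/measurable_EFinP.
apply: (@le_trans _ _ (`|\int[mu]_(y in macroelement f) (F y)%:E|)%E).
  (* An infinite or undefined mean is harmless: [fine] sends infinite values to 0. *)
  rewrite /Rintegral; case: (\int[mu]_(y in macroelement f) (F y)%:E)%E => //=.
  - by rewrite normr0 leey.
  - by rewrite normr0 leey.
apply: le_trans (le_abse_integral mu mM mEF) _.
(* The guard makes [F1 K] measurable for every [K], as the integral of the sum requires; simplices
   are known to be measurable only for cells. *)
pose F1 K y : \bar R :=
  if K \in cells T then (\1_(simplex x_ K) y * `|F y|)%:E else 0%E.
have F10 K y : (0 <= F1 K y)%E.
  by rewrite /F1; case: ifP => // _; rewrite lee_fin mulr_ge0.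
have mF1 K : measurable_fun setT (F1 K).
  rewrite /F1; case: (boolP (K \in cells T)) => // KT.
  apply/measurable_EFinP; apply: measurable_funM; last exact: measurableT_comp.
  by apply: measurable_indic; exact: measurable_simplex (cell_indep KT) (LP K KT).
have -> : (\sum_(K in cells T | f \subset K)
      \int[mu]_y (\1_(simplex x_ K) y * `|F y|)%:E =
    \int[mu]_y \sum_(K in cells T | f \subset K) F1 K y)%E.
  under [RHS]eq_integral do rewrite -big_filter.
  rewrite ge0_integral_sum// big_filter; apply: eq_bigr => K /andP[KT _].
  by rewrite /F1 KT.
rewrite integral_mkcond; apply: ge0_le_integral => //.
- by move=> y _; apply: erestrict_ge0 => z _; exact: abse_ge0.
- by apply/(measurable_restrictT _ mM); exact: measurableT_comp.
- under eq_fun do rewrite -big_filter.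
  exact: emeasurable_sum.
move=> y _; rewrite patchE; case: ifP => [|_]; last by rewrite sume_ge0.
rewrite inE => -[K [KT fK] yK].
rewrite (bigD1 K)/=; last by rewrite KT.
rewrite /F1 KT indicE mem_set// mul1r leeDl// sume_ge0// => K' _; exact: F10.
Qed.

Section domination.
Variables (L : {set V} -> V -> 'rV[R]_n -> R) (f : {set V}).
Hypothesis LP : forall K, K \in cells T -> is_coords x_ K (L K).
Hypotheses (fT : f \in subsimplexes T) (fn : dim f != n).

(** The contribution to [Cop f v x] of the projection [I] and of the part of the mean over [K'], for
    [x] in [K], up to the factor [1 / |Omega_f|]. *)
Let S (K I K' : {set V}) v x : \bar R :=
  ((\1_(simplex x_ K `&`
        [set y | (0 < 1 - \sum_(j in f :\: I) L K j y)%R]) x)%:E *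
      (\int[mu]_y (\1_(simplex x_ K') y *
         `|v ((1 - \sum_(j in f :\: I) L K j x) *: y +
              \sum_(j in f :\: I) L K j x *: x_ j)|)%:E))%E.

Let S0 K I K' v x : (0 <= S K I K' v x)%E.
Proof.
by rewrite mule_ge0 ?lee_fin// integral_ge0// => y _; rewrite lee_fin mulr_ge0.
Qed.

Let S_sublinear : L2_sublinear (fun v x =>
  \sum_(K in cells T | f \subset K) \sum_(I : {set V} | I \subset f)
    \sum_(K' in cells T | f \subset K') S K I K' v x)%E.
Proof.
apply: L2_sublinear_sum => K /andP[KT fK].
apply: L2_sublinear_sum => I If.
apply: L2_sublinear_sum => K' /andP[KT' fK'].
have gf : f :\: I \subset f by exact: finset.subsetDl.
apply: (cell_L2_sublinear (cell_indep KT) (LP KT) (cell_indep KT') (LP KT')).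
- exact: fintype.subset_trans fK.
- exact: fintype.subset_trans fK'.
have f0 : f != finset.set0 by move: fT; rewrite inE => /andP[].
have cf : #|f| = (dim f).+1 by rewrite /dim prednK// card_gt0.
(* If [f :\: I] were all of [K'], then [f] would have [n + 1] vertices and dimension [n]. *)
apply: contraNneq fn => fIK; have := subset_leq_card gf.
rewrite fIK (cell_card KT') cf ltnS => nf.
by have := subset_leq_card fK; rewrite cf (cell_card KT) ltnS eqn_leq nf => ->.
Qed.

(** At a point where [Cop f v] is nonzero, [x] lies in a cell [K] containing [f], on which the
    barycentric coordinates of the vertices of [f] are those of [K]. The quotients of complements
    lie in [[0, 1]], so only the means remain to be bounded. *)
Let Cop_le v x : measurable_fun setT v ->
  (`|Cop f v x|%:E <= `|(fine (mu (macroelement f)))^-1|%:E *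
    \sum_(K in cells T | f \subset K) \sum_(I : {set V} | I \subset f)
      \sum_(K' in cells T | f \subset K') S K I K' v x)%E.
Proof.
move=> mv.
have sum0 K : (0 <= \sum_(I : {set V} | I \subset f)
      \sum_(K' in cells T | f \subset K') S K I K' v x)%E.
  by apply: sume_ge0 => I _; apply: sume_ge0 => K' _; exact: S0.
have [->|C0] := eqVneq (Cop f v x) 0.
  by rewrite normr0 mule_ge0// ?lee_fin// sume_ge0.
have xOm : Om x.
  move: C0; rewrite /Cop patchE; case: ifP => [|]; last by rewrite eqxx.
  by rewrite inE.
have [K KT xK] := closure_cell (subset_closure xOm).
have bi i : i \in f -> i \in K /\ bary i x = L K i x.
  move=> fi; apply: (bary_cell KT (LP KT) xK).
  by apply: contra C0 => /eqP bi; rewrite (Cop_eq0 v fn fi bi).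
have fK : f \subset K by apply/fintype.subsetP => i /bi[].
apply: (@le_trans _ _ (`|(fine (mu (macroelement f)))^-1|%:E *
    \sum_(I : {set V} | I \subset f)
      \sum_(K' in cells T | f \subset K') S K I K' v x)%E); last first.
  apply: lee_wpmul2l; first by rewrite lee_fin.
  by rewrite [leRHS](bigD1 K) ?KT//= leeDl// sume_ge0.
rewrite ge0_sume_distrr; last by move=> I _; apply: sume_ge0 => K' _; exact: S0.
rewrite /Cop (negPf fn) patchE mem_set//.
apply: (@le_trans _ _ (\sum_(I : {set V} | I \subset f)
  `|(-1) ^+ #|I| * (bfun f (bary_at x) / bfun f (proj I (bary_at x)))
       * Aop f v (proj I (bary_at x))|%:E)%E).
  by rewrite sumEFin lee_fin ler_norm_sum.
apply: lee_sum => I If.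
have gE : \sum_(j in f :\: I) bary_at x j = \sum_(j in f :\: I) L K j x.
  by apply: eq_bigr => j; rewrite inE => /andP[_ /bi[]].
have Lx j : j \in K -> 0 <= L K j x.
  by move=> jK; have /andP[] := coords_le1 (cell_indep KT) (LP KT) xK jK.
have b0 : 0 <= bfun f (bary_at x).
  rewrite /bfun (eq_bigr (L K ^~ x)); last by move=> j /bi[].
  have [_ l1 _] := LP KT.
  rewrite -(l1 x) [X in X - _](big_setID f)/= (finset.setIidPr fK) addrAC subrr.
  by rewrite add0r sumr_ge0// => j; rewrite inE => /andP[_ /Lx].
have bI : bfun f (bary_at x) <= bfun f (proj I (bary_at x)).
  rewrite bfun_proj /bfun lerD2l lerN2 [leRHS](big_setID I)/= lerDr.
  apply: sumr_ge0 => j; rewrite inE => /andP[/bi[jK jE] _].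
  by rewrite /bary_at jE Lx.
have [bI0|bI0] := ltP 0 (bfun f (proj I (bary_at x))); last first.
  (* A vanishing denominator makes the whole term 0 by the convention on division. *)
  have -> : bfun f (proj I (bary_at x)) = 0.
    by apply/eqP; rewrite eq_le bI0 (le_trans b0 bI).
  by rewrite invr0 mulr0 mulr0 mul0r normr0 mule_ge0 ?lee_fin// sume_ge0.
rewrite /Aop !normrM normrX normrN1 expr1n mul1r.
have r1 : `|bfun f (bary_at x)| * `|(bfun f (proj I (bary_at x)))^-1| <= 1.
  rewrite normfV !ger0_norm// ?(le_trans b0 bI)//.
  by rewrite ler_pdivrMr// mul1r.
apply: (@le_trans _ _ (`|(fine (mu (macroelement f)))^-1|%:E *
   `|\int[mu]_(y in macroelement f) v (y + \sum_(j in f)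
        proj I (bary_at x) j *: (x_ j - y))|%:E)%E).
  by rewrite -EFinM lee_fin ler_piMl// mulr_ge0.
apply: lee_wpmul2l; first by rewrite lee_fin.
(* Regrouping the argument of [v] exhibits it as a homothety in [y]. *)
have E y : y + \sum_(j in f) proj I (bary_at x) j *: (x_ j - y) =
    (1 - \sum_(j in f :\: I) L K j x) *: y + \sum_(j in f :\: I) L K j x *: x_ j.
  rewrite sum_proj (eq_bigr (fun j => L K j x *: x_ j - L K j x *: y));
    last first.
    by move=> j; rewrite inE => /andP[_ /bi[_ jE]]; rewrite /bary_at jE scalerBr.
  by rewrite sumrB scalerBl scale1r scaler_suml [RHS]addrAC addrA.
under eq_Rintegral do rewrite E.
apply: le_trans (abs_Rintegral_macroelement f _) _.
  by apply: measurableT_comp => //; exact: measurable_rv_addZ.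
apply: lee_sum => K' _; rewrite /S indicE mem_set ?mul1e//.
by split => //=; move: bI0; rewrite bfun_proj gE.
Qed.

Lemma Cop_L2_dim_neq : L2_operator (Cop f).
Proof.
apply: (L2_operator_dom _ S_sublinear (fun v => Cop_measurable fT)) Cop_le.
exact: normr_ge0.
Qed.

End domination.

Lemma Cop_L2 f : f \in subsimplexes T -> L2_operator (Cop f).
Proof.
move=> fT; have [L LP] := exists_cell_coords.
have [fn|fn] := eqVneq (dim f) n; last exact: Cop_L2_dim_neq LP fT fn.
have fK := dim_cell fT fn.
have mf : measurable (simplex x_ f)
  by exact: measurable_simplex (cell_indep fK) (LP f fK).
apply: eq_L2_operator (L2_operator_comp (L2_operator_restrict mOm)
  (L2_operator_restrict mf)) _ => v.
by rewrite /Cop fn eqxx.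
Qed.

Lemma residual_L2 m : L2_operator (residual T m).
Proof.
elim: m => [|m IH]; first exact: L2_operator_restrict.
apply: L2_operatorB_sum => // g /andP[gT _].
exact: L2_operator_comp (Cop_L2 gT) IH.
Qed.

Lemma bubble_L2 f : f \in subsimplexes T -> L2_operator (bubble f).
Proof. by move=> fT; exact: L2_operator_comp (Cop_L2 fT) (residual_L2 _). Qed.

Lemma bubble_restrict f v : bubble f (v \_ Om) = bubble f v.
Proof.
rewrite /bubble; congr Cop; elim: (dim f) => [|m /= -> //].
by apply/funext => x /=; rewrite !patchE; case: (x \in Om).
Qed.

Lemma bubble_outside f v : bubble f v \_ Om = bubble f v.
Proof. by apply/funext => x; rewrite /bubble /Cop !patchE; case: (x \in Om). Qed.

End bubble_bound.

Lemma inL2E (R : realType) n (Om : set 'rV[R]_n) u : inL2 Om u <->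
  measurable_fun setT (u \_ Om) /\
  (\int[lebesgue_rv R n]_x ((u \_ Om) x ^+ 2)%:E < +oo)%E.
Proof.
rewrite -Lnorm2_sqr /inL2; set N := Lnorm _ _ _.
have N0 : (0 <= N)%E by exact: Lnorm_ge0.
have NE : (N ^+ 2 < +oo)%E <-> (N < +oo)%E.
  case: N N0 => [r _| |]//.
    by rewrite -EFin_expe !ltry.
split.
  by rewrite inE => /andP[]; rewrite !inE/= => mu Nu; split => //; exact/NE.
by move=> [mu /NE Nu]; apply/andP; rewrite !inE.
Qed.

Theorem corollary4p7 (R : realType) (n : nat) (Om : set 'rV[R]_n)
    (T : triangulation Om) :
  bounded_polyhedral_domain Om ->
  (exists c : R, forall u : 'rV[R]_n -> R, inL2 Om u ->
     (forall f, f \in subsimplexes T -> inL2 Om (bubble f u)) /\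
     (\sum_(f in subsimplexes T) L2norm Om (bubble f u) ^+ 2
        <= c%:E * L2norm Om u ^+ 2)%E) /\
  (forall u : 'rV[R]_n -> R, inL2 Om u ->
     forall f, f \in subsimplexes T ->
       ess_support Om (bubble f u) `<=` closure (macroelement f)).
Proof.
move=> [_ oOm _ _ _]; split; last first.
  move=> u _ f fT y ys; apply: contrapT => /= ny.
  (* On this open set [bubble f u] vanishes at every point, so no point of it belongs to the
     essential support. *)
  have oU : open_nbhs y (~` closure (macroelement f)).
    by split => //; exact/closed_openC/closed_closure.
  apply: (ys _ oU); apply: aeW => z [zU _].
  apply: contrapT => /eqP Bz; apply: zU; apply: subset_closure.
  exact: Cop_support fT Bz.
have /choice[C CP] : forall f : {set vtx T}, exists C : R, f \in subsimplexes T ->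
    0 <= C /\ forall v, measurable_fun setT v ->
    measurable_fun setT (bubble f v) /\
    (\int[lebesgue_rv R n]_x (bubble f v x ^+ 2)%:E <=
      C%:E * \int[lebesgue_rv R n]_x (v x ^+ 2)%:E)%E.
  move=> f; have [fT|] := boolP (f \in subsimplexes T); last by exists 0.
  by have [C C0 CP] := bubble_L2 oOm fT; exists C.
exists (\sum_(f in subsimplexes T) C f) => u /inL2E[mu uoo].
have v2 : (0 <= \int[lebesgue_rv R n]_x ((u \_ Om) x ^+ 2)%:E)%E.
  by apply: integral_ge0 => x _; rewrite lee_fin sqr_ge0.
have bound f : f \in subsimplexes T -> measurable_fun setT (bubble f u) /\
    (\int[lebesgue_rv R n]_x (bubble f u x ^+ 2)%:E <=
      (C f)%:E * \int[lebesgue_rv R n]_x ((u \_ Om) x ^+ 2)%:E)%E.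
  (* Only the restriction of [u] to [Om] is known to be measurable, so the bound is applied to that
     restriction, which has the same bubbles. *)
  by move=> fT; rewrite -bubble_restrict; have [_] := CP f fT; apply.
split => [f fT|].
  apply/inL2E; rewrite bubble_outside; have [mb ib] := bound f fT.
  split => //; apply: le_lt_trans ib _.
  apply: lte_mul_pinfty => //; rewrite ?lee_fin//; by have [] := CP f fT.
rewrite /L2norm Lnorm2_sqr -sumEFin ge0_sume_distrl; last first.
  by move=> f fT; rewrite lee_fin; have [] := CP f fT.
apply: lee_sum => f fT; rewrite Lnorm2_sqr bubble_outside.
by have [] := bound f fT.
Qed.
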